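(* Let $\{A(t,\varphi): t\in\mathbb R,\varphi\in E\}$ be a family of m-dissipative operators in $X$, and suppose that either (i) $A$ satisfies the uniformly continuous control condition with data $(h,k,K_0,L_1,L_2)$ and $K_0<-\omega$, or (ii) $A$ satisfies the Lipschitz control condition with data $(g,h,k,K_0,L_1,L_2)$ and $\max\{K_0,L_g\}<-\omega$, where $L_g$ is the Lipschitz constant of $g$. Let $Y\subset BUC(\mathbb R,X)$ be a closed and translation invariant linear subspace. If for all $\lambda>0$ and all $\psi,f\in Y$ the function $$t\mapsto J_\lambda^\omega(t,\psi_t)f(t)$$ belongs to $Y$, then the equation $$u'(t)\in A(t,u_t)u(t)+\omega u(t),\quad t\in\mathbb R,$$ has a solution $u\in Y$.
   Context: $X$ is a Banach space, $\omega\in\mathbb R$, $\mathbb R^+=[0,\infty)$. $BUC(J,X)$ denotes the bounded uniformly continuous functions $J\to X$ with the sup norm. Either (infinite delay) $\mathbb I=(-\infty,0]$ and $E=BUC((-\infty,0],X)$, or (finite delay) $\mathbb I=[-r,0]$ for some $r>0$ and $E=C([-r,0],X)$; $E$ carries the sup norm $\|\cdot\|_E$. For $u\in BUC(\mathbb R,X)$ and $t\in\mathbb R$, $u_t\in E$ is $u_t(s)=u(t+s)$, $s\in\mathbb I$. The operators $A(t,\varphi)\subset X\times X$ may be multivalued, with domain depending on $(t,\varphi)$; m-dissipative means dissipative with $R(I-\lambda A(t,\varphi))=X$ for all $\lambda>0$. For $t\in\mathbb R$, $\varphi\in E$, $x\in X$ and $\lambda>0$ with $\lambda\omega<1$, $J_\lambda^\omega(t,\varphi)x=(I-\lambda(A(t,\varphi)+\omega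 I))^{-1}x$. Uniformly continuous control condition with data $(h,k,K_0,L_1,L_2)$: $h,k:\mathbb R\to X$ are bounded and uniformly continuous, $K_0>0$, $L_1,L_2:\mathbb R^+\to\mathbb R^+$ are continuous and non-decreasing, and for all $\lambda>0$, $t_1,t_2\in\mathbb R$, $\varphi_1,\varphi_2\in E$, $[x_i,y_i]\in A(t_i,\varphi_i)$ ($i=1,2$), $$\|x_1-x_2\|\le\|x_1-x_2-\lambda(y_1-y_2)\|+\lambda\|h(t_1)-h(t_2)\|L_1(\|x_2\|)+\lambda\|k(t_1)-k(t_2)\|L_2(\|\varphi_2\|_E)+K_0\lambda\|\varphi_1-\varphi_2\|_E.$$ Lipschitz control condition with data $(g,h,k,K_0,L_1,L_2)$: $g,h,k:\mathbb R\to X$ are bounded and Lipschitz continuous, $K_0>0$, $L_1,L_2:\mathbb R^+\to\mathbb R^+$ are continuous and non-decreasing, and for all $\lambda>0$, $t_1,t_2\in\mathbb R$, $\varphi_1,\varphi_2\in E$, $[x_i,y_i]\in A(t_i,\varphi_i)$ ($i=1,2$), $$\|x_1-x_2\|\le\|x_1-x_2-\lambda(y_1-y_2)\|+\lambda\|h(t_1)-h(t_2)\|L_1(\|x_2\|)+\lambda\|g(t_1)-g(t_2)\|\,\|y_2\|+\lambda\|k(t_1)-k(t_2)\|L_2(\|\varphi_2\|_E)+K_0\lambda\|\varphi_1-\varphi_2\|_E.$$ Yosida approximation of the derivative: for $\lambda>0$ and $u\in BUC(\mathbb R,X)$, $(\partial_t)_\lambda u(t)=\frac1\lambda\Big(u(t)-\frac1\lambda\int_0^\infty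 e^{-\tau/\lambda}u(t-\tau)\,d\tau\Big)$. Recursion started at $\psi\in BUC(\mathbb R,X)$: for $\lambda>0$, $u_{1,\lambda}\in BUC(\mathbb R,X)$ is the (unique) solution of $(\partial_t)_\lambda u_{1,\lambda}(t)\in A(t,\psi_t)u_{1,\lambda}(t)+\omega u_{1,\lambda}(t)$, $t\in\mathbb R$; given $u_{n,\lambda}$, $u_{n+1,\lambda}\in BUC(\mathbb R,X)$ is the (unique) solution of $(\partial_t)_\lambda u_{n+1,\lambda}(t)\in A(t,(u_{n,\lambda})_t)u_{n+1,\lambda}(t)+\omega u_{n+1,\lambda}(t)$, $t\in\mathbb R$. Solution: $u:\mathbb R\to X$ is called the solution of $u'(t)\in A(t,u_t)u(t)+\omega u(t)$, $t\in\mathbb R$, if for every starting point $\psi\in BUC(\mathbb R,X)$ one has $u=\lim_{n\to\infty}\lim_{\lambda\to0+}u_{n,\lambda}$, both limits existing uniformly on $\mathbb R$. *)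

(* Defs.v *)
From Stdlib Require Import Reals.
From Coquelicot Require Import Coquelicot.

Set Implicit Arguments.
Unset Strict Implicit.
Unset Printing Implicit Defensive.

Open Scope R_scope.

(* Real Banach spaces are Coquelicot's [CompleteNormedModule R_AbsRing].  A
   complex Banach space is covered through its underlying real one. *)

(** * Function spaces *)

Section FunctionSpaces.
Context {X : CompleteNormedModule R_AbsRing} {T : Type}.

(* Equal to the least upper bound only when [f] is bounded and [T] inhabited. *)
Definition sup_norm (f : T -> X) : R :=
  real (Lub_Rbar (fun y => exists t, y = norm (f t))).

Definition dist_sup (f g : T -> X) : R := sup_norm (fun t => minus (f t) (g t)).

Definition bounded (f : T -> X) : Prop := exists M : R, forall t, norm (f t) <= M.

(* [pos : T -> R] identifies [T] with a subset of the line: it is the identity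
   for [T = R] and the first projection for an interval seen as a subtype. *)

Definition continuous_fun (pos : T -> R) (f : T -> X) : Prop :=
  forall (s : T) (eps : posreal), exists delta : posreal, forall t : T,
    Rabs (pos t - pos s) < delta -> norm (minus (f t) (f s)) < eps.

Definition unif_continuous (pos : T -> R) (f : T -> X) : Prop :=
  forall eps : posreal, exists delta : posreal, forall s t : T,
    Rabs (pos t - pos s) < delta -> norm (minus (f t) (f s)) < eps.

Definition buc_on (pos : T -> R) (f : T -> X) : Prop :=
  bounded f /\ unif_continuous pos f.

End FunctionSpaces.

Definition BUC {X : CompleteNormedModule R_AbsRing} (u : R -> X) : Prop :=
  buc_on (fun t : R => t) u.

Definition lipschitz {X : CompleteNormedModule R_AbsRing} (g : R -> X) : Prop :=
  exists L : R, forall s t : R, norm (minus (g s) (g t)) <= L * Rabs (s - t).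

(* The least Lipschitz constant, when [g] is Lipschitz. *)
Definition lipschitz_const {X : CompleteNormedModule R_AbsRing} (g : R -> X) : R :=
  real (Lub_Rbar (fun q => exists s t : R,
          s <> t /\ q = norm (minus (g s) (g t)) / Rabs (s - t))).

(** * Delay and history space *)

Inductive delay : Type :=
  | InfiniteDelay
  | FiniteDelay (r : posreal).

Definition delay_set (d : delay) (s : R) : Prop :=
  match d with
  | InfiniteDelay => s <= 0
  | FiniteDelay r => - r <= s <= 0
  end.

Definition delay_interval (d : delay) : Type := {s : R | delay_set d s}.

Definition delay_pos (d : delay) (s : delay_interval d) : R := proj1_sig s.

(* The space [E], as a predicate on functions defined on the delay interval. *)
Definition in_E {X : CompleteNormedModule R_AbsRing} (d : delay)
    (phi : delay_interval d -> X) : Prop :=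
  match d with
  | InfiniteDelay => buc_on (@delay_pos d) phi
  | FiniteDelay _ => continuous_fun (@delay_pos d) phi
  end.

Definition history {X : CompleteNormedModule R_AbsRing} (d : delay)
    (u : R -> X) (t : R) : delay_interval d -> X :=
  fun s => u (t + delay_pos s).

(** * Multivalued operators *)

(* [B x y] stands for [x, y] in the graph of [B], that is, y in B x. *)
Definition operator (X : CompleteNormedModule R_AbsRing) : Type := X -> X -> Prop.

Definition dissipative {X : CompleteNormedModule R_AbsRing} (B : operator X) : Prop :=
  forall (lambda : R) (x1 y1 x2 y2 : X), 0 < lambda -> B x1 y1 -> B x2 y2 ->
    norm (minus x1 x2)
      <= norm (minus (minus x1 x2) (scal lambda (minus y1 y2))).

Definition m_dissipative {X : CompleteNormedModule R_AbsRing} (B : operator X) : Prop :=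
  dissipative B /\
  forall lambda : R, 0 < lambda ->
    forall z : X, exists x y : X, B x y /\ z = minus x (scal lambda y).

Definition op_shift {X : CompleteNormedModule R_AbsRing}
    (B : operator X) (omega : R) : operator X :=
  fun x y => exists z : X, B x z /\ y = plus z (scal omega x).

(* (I - lambda B)^{-1} x.  [iota] picks the unique element with the given
   property; the value is meaningless if there is none or more than one. *)
Definition resolvent {X : CompleteNormedModule R_AbsRing}
    (B : operator X) (lambda : R) (x : X) : X :=
  iota (fun z : X => exists y : X, B z y /\ x = minus z (scal lambda y)).

Definition J {X : CompleteNormedModule R_AbsRing} (d : delay)
    (A : R -> (delay_interval d -> X) -> operator X) (omega lambda t : R)
    (phi : delay_interval d -> X) (x : X) : X :=
  resolvent (op_shift (A t phi) omega) lambda x.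

(** * Control conditions *)

(* Continuous non-decreasing maps of [0, oo) into itself, represented by maps
   R -> R whose values at negative reals are irrelevant. *)
Definition control_fun (L : R -> R) : Prop :=
  (forall x, 0 <= x -> 0 <= L x) /\
  (forall x, 0 <= x ->
     filterlim L (within (fun y => 0 <= y) (locally x)) (locally (L x))) /\
  (forall x y, 0 <= x -> x <= y -> L x <= L y).

Section Control.
Context {X : CompleteNormedModule R_AbsRing} {d : delay}.
Variable A : R -> (delay_interval d -> X) -> operator X.

Definition uc_control (h k : R -> X) (K0 : R) (L1 L2 : R -> R) : Prop :=
  BUC h /\ BUC k /\ 0 < K0 /\ control_fun L1 /\ control_fun L2 /\
  forall (lambda t1 t2 : R) (phi1 phi2 : delay_interval d -> X) (x1 y1 x2 y2 : X),
    0 < lambda -> in_E phi1 -> in_E phi2 -> A t1 phi1 x1 y1 -> A t2 phi2 x2 y2 ->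
    norm (minus x1 x2)
      <= norm (minus (minus x1 x2) (scal lambda (minus y1 y2)))
         + lambda * norm (minus (h t1) (h t2)) * L1 (norm x2)
         + lambda * norm (minus (k t1) (k t2)) * L2 (sup_norm phi2)
         + K0 * lambda * dist_sup phi1 phi2.

Definition lip_control (g h k : R -> X) (K0 : R) (L1 L2 : R -> R) : Prop :=
  (bounded g /\ lipschitz g) /\ (bounded h /\ lipschitz h) /\
  (bounded k /\ lipschitz k) /\ 0 < K0 /\ control_fun L1 /\ control_fun L2 /\
  forall (lambda t1 t2 : R) (phi1 phi2 : delay_interval d -> X) (x1 y1 x2 y2 : X),
    0 < lambda -> in_E phi1 -> in_E phi2 -> A t1 phi1 x1 y1 -> A t2 phi2 x2 y2 ->
    norm (minus x1 x2)
      <= norm (minus (minus x1 x2) (scal lambda (minus y1 y2)))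
         + lambda * norm (minus (h t1) (h t2)) * L1 (norm x2)
         + lambda * norm (minus (g t1) (g t2)) * norm y2
         + lambda * norm (minus (k t1) (k t2)) * L2 (sup_norm phi2)
         + K0 * lambda * dist_sup phi1 phi2.

End Control.

(** * Approximation scheme and solutions *)

Definition yosida_dt {X : CompleteNormedModule R_AbsRing}
    (lambda : R) (u : R -> X) (t : R) : X :=
  scal (/ lambda)
    (minus (u t)
       (scal (/ lambda)
          (RInt_gen (fun tau => scal (exp (- tau / lambda)) (u (t - tau)))
             (at_point 0) (Rbar_locally p_infty)))).

Section Solutions.
Context {X : CompleteNormedModule R_AbsRing} {d : delay}.
Variables (A : R -> (delay_interval d -> X) -> operator X) (omega : R).

Definition approx_solution (lambda : R) (psi v : R -> X) : Prop :=
  BUC v /\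
  forall t : R, op_shift (A t (history psi t)) omega (v t) (yosida_dt lambda v t).

(* [U n lambda] is u_{n,lambda}, with the convention u_{0,lambda} = psi. *)
Definition recursion (psi : R -> X) (U : nat -> R -> R -> X) : Prop :=
  forall lambda : R, 0 < lambda ->
    U 0%nat lambda = psi /\
    forall n : nat, unique (approx_solution lambda (U n lambda)) (U (S n) lambda).

(* The neighbourhoods of a function in [fct_UniformSpace R X] are those of
   uniform convergence on R. *)
Definition is_solution (u : R -> X) : Prop :=
  forall psi : R -> X, BUC psi ->
    exists (U : nat -> R -> R -> X) (v : nat -> R -> X),
      recursion psi U /\
      (forall n : nat,
         filterlim (U n) (at_right 0) (locally (v n : fct_UniformSpace R X))) /\
      filterlim v eventually (locally (u : fct_UniformSpace R X)).

End Solutions.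

(** * Subspaces of BUC(R, X) *)

Section Subspaces.
Context {X : CompleteNormedModule R_AbsRing}.
Variable Y : (R -> X) -> Prop.

Definition linear_subspace_BUC : Prop :=
  (forall u, Y u -> BUC u) /\
  Y (fun _ => zero) /\
  (forall u v, Y u -> Y v -> Y (fun t => plus (u t) (v t))) /\
  (forall (c : R) u, Y u -> Y (fun t => scal c (u t))).

Definition closed_in_BUC : Prop :=
  forall u : R -> X, BUC u ->
    (forall eps : posreal, exists v, Y v /\ dist_sup u v < eps) -> Y u.

Definition translation_invariant : Prop :=
  forall (a : R) u, Y u -> Y (fun t => u (t + a)).

End Subspaces.

(* Main.v *)
Require Import Defs.
From Stdlib Require Import Reals Lra Lia List FunctionalExtensionality ClassicalEpsilon.
From Coquelicot Require Import Coquelicot.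
Open Scope R_scope.

(** Put [beta = - omega > 0] and write [P u t] for the exponential mean
    [1/lambda * int_0^oo e^(-s/lambda) u(t - s) ds], so that the approximate
    equation is the fixed point equation [v t = J (P v t)], a strict contraction
    with constant [1 / (1 + lambda beta)] on every admissible subspace, since [P]
    is a limit of combinations of translates.  For the limit [lambda -> 0], the
    control condition turns [D(t,s) = |u_lambda t - u_mu s|] into a subsolution of
    a doubly discretised transport equation with damping [beta]; comparison with
    [e + C (t-s)^2 / beta] shows that [u_lambda] is uniformly Cauchy as soon as
    the control terms are at most [eps + C (t-s)^2].  Under the Lipschitz
    condition this needs a bound on [y_2] uniform in [lambda], which follows from
    a uniform Lipschitz bound for [u_lambda] ([L_g < beta]) when the starting
    point is Lipschitz; such starting points are dense, and the scheme depends
    on its starting point with constant [(K0 / beta)^n].  The last fact also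
    gives the limit [n -> oo] and its independence of the starting point.  Both
    hypotheses are treated at once: under the first, [g = 0]. *)

(** * Linear identities in a module *)

(** The comparison functions are quadratic because the exponential law of mean [lambda] has moments
    [1], [lambda], [2 * lambda ^ 2]: means act explicitly on quadratics, and every modulus of
    uniform continuity of a bounded function lies below some [eps + C * r ^ 2]. In the doubled
    inequality the terms linear in [t - s] cancel after weighting by [lambda] and [mu]; the rest is
    of order [lambda + mu]. Suprema over the line need not be attained, so each maximum principle
    reads: a bounded function whose upper bounds [m] improve to [q * m + c], with [q < 1], is at
    most [c / (1 - q)]. The obstacle under the Lipschitz condition is that the a priori bound on
    elements of [A] is of order [1 / lambda]. It only serves to make the Lipschitz constant of the
    approximate solution finite; an inequality of ratio [L_g / beta] then bounds this constant
    uniformly. At stage [n + 1] the histories themselves depend on [lambda]; convergence at stage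
    [n] turns the history term into a small constant plus a quadratic modulus of the limit. *)

Inductive vexpr : Type :=
  | VVar (i : nat)
  | VZero
  | VPlus (a b : vexpr)
  | VOpp (a : vexpr)
  | VScal (c : R) (a : vexpr).

Fixpoint vcoef (e : vexpr) (i : nat) : R :=
  match e with
  | VVar j => if Nat.eqb i j then 1 else 0
  | VZero => 0
  | VPlus a b => vcoef a i + vcoef b i
  | VOpp a => - vcoef a i
  | VScal c a => c * vcoef a i
  end.

(** Computes to a conjunction of finitely many real identities, one per atom, that [ring] and
    [field] can close. *)
Fixpoint coefs_eq (n : nat) (c c' : nat -> R) : Prop :=
  match n with
  | O => True
  | S n => c O = c' O /\ coefs_eq n (fun i => c (S i)) (fun i => c' (S i))
  end.

Section LinearIdentities.
Context {V : ModuleSpace R_Ring}.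

Fixpoint vdenote (env : list V) (e : vexpr) : V :=
  match e with
  | VVar i => nth i env zero
  | VZero => zero
  | VPlus a b => plus (vdenote env a) (vdenote env b)
  | VOpp a => opp (vdenote env a)
  | VScal c a => scal c (vdenote env a)
  end.

Fixpoint lincomb (env : list V) (c : nat -> R) : V :=
  match env with
  | nil => zero
  | x :: l => plus (scal (c O) x) (lincomb l (fun i => c (S i)))
  end.

Lemma lincomb_ext (env : list V) (c c' : nat -> R) :
  coefs_eq (length env) c c' -> lincomb env c = lincomb env c'.
Proof.
  revert c c'; induction env as [|x l IH]; intros c c' H; [reflexivity|].
  destruct H as [H0 H]; simpl; rewrite H0, (IH _ _ H); reflexivity.
Qed.

Lemma coefs_eq_pointwise (n : nat) (c c' : nat -> R) :
  (forall i, c i = c' i) -> coefs_eq n c c'.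
Proof.
  revert c c'; induction n as [|n IH]; intros c c' H; simpl; auto.
Qed.

Lemma lincomb_zero (env : list V) : lincomb env (fun _ => 0) = zero.
Proof.
  induction env as [|x l IH]; [reflexivity|].
  simpl; rewrite IH, plus_zero_r; exact (scal_zero_l x).
Qed.

Lemma lincomb_plus (env : list V) (c c' : nat -> R) :
  lincomb env (fun i => c i + c' i) = plus (lincomb env c) (lincomb env c').
Proof.
  revert c c'; induction env as [|x l IH]; intros c c'; simpl.
  - now rewrite plus_zero_r.
  - rewrite IH.
    change (c O + c' O) with (plus (c O : R_Ring) (c' O)).
    rewrite scal_distr_r, <- !plus_assoc; f_equal.
    rewrite !plus_assoc; f_equal; apply plus_comm.
Qed.

Lemma lincomb_scal (env : list V) (a : R) (c : nat -> R) :
  lincomb env (fun i => a * c i) = scal a (lincomb env c).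
Proof.
  revert c; induction env as [|x l IH]; intros c; simpl.
  - symmetry; apply scal_zero_r.
  - rewrite IH, scal_distr_l, scal_assoc; reflexivity.
Qed.

Lemma lincomb_var (env : list V) (i : nat) :
  lincomb env (fun j => if Nat.eqb j i then 1 else 0) = nth i env zero.
Proof.
  revert i; induction env as [|x l IH]; intros [|i]; simpl; try reflexivity.
  - rewrite lincomb_zero, plus_zero_r; exact (scal_one x).
  - rewrite IH; etransitivity; [|apply plus_zero_l]; f_equal; exact (scal_zero_l x).
Qed.

Lemma vdenote_lincomb (env : list V) (e : vexpr) :
  vdenote env e = lincomb env (vcoef e).
Proof.
  induction e as [i| |a IHa b IHb|a IHa|c a IHa]; simpl.
  - symmetry; apply lincomb_var.
  - symmetry; apply lincomb_zero.
  - now rewrite IHa, IHb, <- lincomb_plus.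
  - rewrite IHa, <- scal_opp_one.
    change (@opp R_Ring one) with (- (1)).
    rewrite <- lincomb_scal; apply lincomb_ext, coefs_eq_pointwise.
    intros i; ring.
  - now rewrite IHa, <- lincomb_scal.
Qed.

Lemma vexpr_eq (env : list V) (a b : vexpr) :
  coefs_eq (length env) (vcoef a) (vcoef b) -> vdenote env a = vdenote env b.
Proof. intros H; rewrite !vdenote_lincomb; now apply lincomb_ext. Qed.

End LinearIdentities.

(** * Reification of linear expressions *)

Ltac vec_index x l :=
  lazymatch l with
  | x :: _ => constr:(O)
  | _ :: ?l' => let n := vec_index x l' in constr:(S n)
  end.

Ltac vec_add x l :=
  let rec mem l' :=
    lazymatch l' with
    | nil => constr:(x :: l)
    | x :: _ => l
    | _ :: ?l'' => mem l''
    end in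
  mem l.

Ltac vec_atoms e l :=
  lazymatch e with
  | plus ?a ?b => let l' := vec_atoms a l in vec_atoms b l'
  | minus ?a ?b => let l' := vec_atoms a l in vec_atoms b l'
  | opp ?a => vec_atoms a l
  | scal _ ?a => vec_atoms a l
  | zero => l
  | _ => vec_add e l
  end.

Ltac vec_reify e l :=
  lazymatch e with
  | plus ?a ?b =>
      let a' := vec_reify a l in let b' := vec_reify b l in constr:(VPlus a' b')
  | minus ?a ?b =>
      let a' := vec_reify a l in let b' := vec_reify b l in
      constr:(VPlus a' (VOpp b'))
  | opp ?a => let a' := vec_reify a l in constr:(VOpp a')
  | scal ?c ?a => let a' := vec_reify a l in constr:(VScal c a')
  | zero => constr:(VZero)
  | _ => let i := vec_index e l in constr:(VVar i)
  end.

(** Reduces an equation between linear expressions in [X] to one real identity per atom. Identities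
    beyond the reach of [ring], such as those with divisions, are left to the caller. *)
Ltac vec :=
  lazymatch goal with
  | X : CompleteNormedModule R_AbsRing |- ?a = ?b =>
      let V := constr:(CompleteNormedModule.ModuleSpace R_AbsRing X) in
      let l0 := constr:(@nil (ModuleSpace.sort R_Ring V)) in
      let l1 := vec_atoms a l0 in
      let l := vec_atoms b l1 in
      let a' := vec_reify a l in
      let b' := vec_reify b l in
      change (@vdenote V l a' = @vdenote V l b');
      apply vexpr_eq; cbn; repeat split; try ring
  end.

(** * Norms, suprema and uniform limits *)

(** The improvement step applied to the least upper bound [m] gives [m <= q * m + c]. The crude
    bound [M] only makes [m] finite and leaves no trace in the conclusion, so it may depend badly on
    parameters. *)
Lemma sup_contraction {T : Type} (f : T -> R) (q c : R) :
  q < 1 ->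
  (exists M, forall t, f t <= M) ->
  (forall m, (forall t, f t <= m) -> forall t, f t <= q * m + c) ->
  forall t, f t <= c / (1 - q).
Proof.
  intros Hq [M HM] H t0.
  destruct (completeness (fun y => exists t, y = f t)) as [m [Hub Hlub]].
  - exists M; intros y [t ->]; apply HM.
  - exists (f t0), t0; reflexivity.
  - assert (Hm : forall t, f t <= m) by (intros t; apply Hub; exists t; reflexivity).
    assert (Hle : m <= q * m + c)
      by (apply Hlub; intros y [t ->]; apply H; exact Hm).
    apply Rle_trans with m; [apply Hm|].
    apply Rle_div_r; lra.
Qed.

Lemma le_of_le_eps (a b : R) : (forall eps, 0 < eps -> a <= b + eps) -> a <= b.
Proof.
  intros H; destruct (Rle_or_lt a b) as [|Hlt]; [assumption|].
  specialize (H ((a - b) / 2)); lra.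
Qed.

Section Norms.
Context {X : CompleteNormedModule R_AbsRing}.

(** The reverse of the inequality built into the structure is that inequality for [/ a] applied to
    [scal a x]. *)
Lemma norm_scal_eq (a : R) (x : X) : norm (scal a x) = Rabs a * norm x.
Proof.
  apply Rle_antisym; [exact (norm_scal a x)|].
  destruct (Req_dec a 0) as [->|Ha].
  - rewrite Rabs_R0, Rmult_0_l; apply norm_ge_0.
  - replace (norm x) with (norm (scal (/ a) (scal a x)))
      by (f_equal; vec; now field).
    generalize (norm_scal (/ a) (scal a x)).
    change (abs (/ a)) with (Rabs (/ a)).
    rewrite Rabs_inv; intros H.
    apply Rmult_le_compat_l with (r := Rabs a) in H; [|apply Rabs_pos].
    rewrite <- Rmult_assoc, Rinv_r, Rmult_1_l in H; [exact H|].
    now apply Rabs_no_R0.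
Qed.

Lemma norm_minus_sym (x y : X) : norm (minus x y) = norm (minus y x).
Proof. rewrite <- norm_opp; f_equal; vec. Qed.

Lemma norm_minus_triangle (x y z : X) :
  norm (minus x z) <= norm (minus x y) + norm (minus y z).
Proof.
  replace (minus x z) with (plus (minus x y) (minus y z)) by vec.
  exact (norm_triangle (minus x y) (minus y z)).
Qed.

Lemma norm_minus_le (x y : X) : norm (minus x y) <= norm x + norm y.
Proof. rewrite <- (norm_opp y); exact (norm_triangle x (opp y)). Qed.

Lemma norm_le_minus (x y : X) : norm x <= norm (minus x y) + norm y.
Proof.
  replace x with (plus (minus x y) y) at 1 by vec; exact (norm_triangle (minus x y) y).
Qed.

Lemma norm_minus_self (x : X) : norm (minus x x) = 0.
Proof. replace (minus x x) with (zero : X) by vec; exact norm_zero. Qed.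

Lemma eq_of_norm_minus (x y : X) : norm (minus x y) <= 0 -> x = y.
Proof.
  intros H.
  assert (Hz := norm_eq_zero (minus x y) (Rle_antisym _ _ H (norm_ge_0 _))).
  replace x with (plus (minus x y) y) by vec.
  rewrite Hz; exact (plus_zero_l y).
Qed.

Lemma filterlim_fct {T : Type} (F : (T -> Prop) -> Prop) {FF : Filter F}
    (f : T -> R -> X) (v : R -> X) :
  (forall eps, 0 < eps -> F (fun x => forall t, norm (minus (f x t) (v t)) <= eps)) ->
  filterlim f F (locally (v : fct_UniformSpace R X)).
Proof.
  intros H.
  apply (proj2 (@filterlim_locally T (fct_UniformSpace R X) F FF f v)).
  intros eps.
  assert (He : 0 < eps / 2) by (destruct eps; simpl; lra).
  refine (filter_imp _ _ _ (H _ He)).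
  intros x Hx t; apply (norm_compat1 (v t) (f x t)), Rle_lt_trans with (1 := Hx t).
  destruct eps; simpl; lra.
Qed.

Lemma uniform_cauchy_limit {T : Type} (F : (T -> Prop) -> Prop) {FF : ProperFilter F}
    (f : T -> R -> X) :
  (forall eps, 0 < eps -> exists P : T -> Prop, F P /\
     forall x y, P x -> P y -> forall t, norm (minus (f x t) (f y t)) <= eps) ->
  exists v : R -> X, forall eps, 0 < eps ->
    F (fun x => forall t, norm (minus (f x t) (v t)) <= eps).
Proof.
  intros H.
  destruct (proj1 (@filterlim_locally_cauchy T (@fct_CompleteSpace R X) F FF f))
    as [v Hv].
  - intros eps.
    destruct (H (eps / 2)) as [P [HP HPe]]; [destruct eps; simpl; lra|].
    exists P; split; [exact HP|]; intros x y Hx Hy t.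
    apply (norm_compat1 (f x t) (f y t)), Rle_lt_trans with (1 := HPe y x Hy Hx t).
    destruct eps; simpl; lra.
  - exists v; intros eps Heps.
    (* Membership in a ball of radius [r] bounds the norm only by [norm_factor * r]. *)
    assert (HK : 0 < @norm_factor _ X) by apply norm_factor_gt_0.
    assert (He : 0 < eps / @norm_factor _ X) by now apply Rdiv_lt_0_compat.
    refine (filter_imp _ _ _ (proj1 (@filterlim_locally T (fct_UniformSpace R X) F _ f v)
                        Hv (mkposreal _ He))).
    intros x Hx t.
    generalize (norm_compat2 (v t) (f x t) (mkposreal _ He) (Hx t)); simpl.
    intros Hlt; apply Rlt_le; replace eps with (@norm_factor _ X * (eps / @norm_factor _ X));
      [exact Hlt|field; lra].
Qed.

Lemma geometric_limit (f : nat -> R -> X) (q C : R) :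
  0 <= q < 1 ->
  (forall n t, norm (minus (f (S n) t) (f n t)) <= C * q ^ n) ->
  exists v : R -> X, forall eps, 0 < eps ->
    eventually (fun n => forall t, norm (minus (f n t) (v t)) <= eps).
Proof.
  intros Hq Hf.
  assert (HC : 0 <= C).
  { generalize (Hf O 0) (norm_ge_0 (minus (f 1%nat 0) (f O 0))); simpl; lra. }
  (* Keeping the exact value of the geometric sum makes the induction step an identity. *)
  assert (Hp : forall n p t,
             norm (minus (f (n + p)%nat t) (f n t)) <= C / (1 - q) * (q ^ n - q ^ (n + p))).
  { intros n p t; induction p as [|p IH].
    - rewrite Nat.add_0_r, norm_minus_self; lra.
    - rewrite Nat.add_succ_r.
      apply Rle_trans with (1 := norm_minus_triangle _ (f (n + p)%nat t) _).
      apply Rle_trans with (1 := Rplus_le_compat _ _ _ _ (Hf _ t) IH).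
      right; simpl; field; lra. }
  assert (Hb : forall n m t, (n <= m)%nat ->
             norm (minus (f m t) (f n t)) <= C / (1 - q) * q ^ n).
  { intros n m t Hnm; replace m with (n + (m - n))%nat by lia.
    apply Rle_trans with (1 := Hp _ _ t).
    apply Rmult_le_compat_l; [apply Rdiv_le_0_compat; lra|].
    generalize (pow_le q (n + (m - n))); lra. }
  apply (uniform_cauchy_limit eventually f); intros eps Heps.
  assert (HK : 0 <= C / (1 - q)) by (apply Rdiv_le_0_compat; lra).
  destruct (pow_lt_1_zero q) with (y := eps / 2 / (C / (1 - q) + 1)) as [N HN].
  { rewrite Rabs_pos_eq; lra. }
  { apply Rdiv_lt_0_compat; lra. }
  specialize (HN N (Nat.le_refl N)); rewrite Rabs_pos_eq in HN by now apply pow_le.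
  assert (HN' : C / (1 - q) * q ^ N <= eps / 2).
  { apply Rle_trans with ((C / (1 - q) + 1) * q ^ N).
    - generalize (pow_le q N); lra.
    - apply Rlt_le in HN; apply Rle_div_r in HN; lra. }
  exists (fun n => (N <= n)%nat); split; [now exists N|].
  intros n m Hn Hm t.
  apply Rle_trans with (1 := norm_minus_triangle _ (f N t) _).
  rewrite (norm_minus_sym (f N t)).
  generalize (Hb N n t Hn) (Hb N m t Hm); lra.
Qed.

End Norms.
(** * Exponential means *)

(** Cubing [1 + y < exp y] at [y = b / (3 * lambda)] bounds [exp (b / lambda)] below by [y ^ 3],
    while the polynomial is at most [K * b ^ 2] for [b > 1]; the quotient is
    [27 * K * lambda ^ 3 / b]. *)
Lemma exp_decay (lambda A B C : R) :
  0 < lambda ->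
  filterlim (fun b => exp (- b / lambda) * (A + B * b + C * b ^ 2))
    (Rbar_locally p_infty) (locally 0).
Proof.
  intros Hl; apply filterlim_locally; intros eps.
  set (K := Rabs A + Rabs B + Rabs C).
  assert (HK : 0 <= K)
    by (unfold K; generalize (Rabs_pos A) (Rabs_pos B) (Rabs_pos C); lra).
  exists (Rmax 1 (27 * K * lambda ^ 3 / eps)); intros b Hb.
  assert (Hb1 : 1 < b) by (apply Rle_lt_trans with (2 := Hb); apply Rmax_l).
  assert (Hb2 : 27 * K * lambda ^ 3 / eps < b)
    by (apply Rle_lt_trans with (2 := Hb); apply Rmax_r).
  assert (Hpoly : Rabs (A + B * b + C * b ^ 2) <= K * b ^ 2).
  { unfold K; rewrite !Rmult_plus_distr_r.
    assert (Hbb : b <= b ^ 2) by nra.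
    apply Rle_trans with (1 := Rabs_triang _ _), Rplus_le_compat.
    - apply Rle_trans with (1 := Rabs_triang _ _), Rplus_le_compat.
      + generalize (Rabs_pos A); nra.
      + rewrite Rabs_mult, (Rabs_pos_eq b) by lra; generalize (Rabs_pos B); nra.
    - rewrite Rabs_mult, (Rabs_pos_eq (b ^ 2)) by nra; lra. }
  assert (Hx : 0 < b / (3 * lambda)) by (apply Rdiv_lt_0_compat; lra).
  assert (Hexp : exp (b / lambda) = exp (b / (3 * lambda)) ^ 3).
  { set (y := b / (3 * lambda)); replace (b / lambda) with (y + (y + y))
      by (unfold y; field; lra).
    rewrite !exp_plus; ring. }
  assert (Hge : (b / (3 * lambda)) ^ 3 <= exp (b / lambda)).
  { rewrite Hexp; apply pow_incr.
    generalize (exp_ineq1 (b / (3 * lambda))); lra. }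
  assert (Hinv : exp (- b / lambda) <= / (b / (3 * lambda)) ^ 3).
  { replace (- b / lambda) with (- (b / lambda)) by (field; lra).
    rewrite exp_Ropp; apply Rinv_le_contravar; [now apply pow_lt|exact Hge]. }
  change (Rabs (exp (- b / lambda) * (A + B * b + C * b ^ 2) + - 0) < eps).
  rewrite Ropp_0, Rplus_0_r, Rabs_mult, (Rabs_pos_eq (exp _)) by (apply Rlt_le, exp_pos).
  apply Rle_lt_trans with (/ (b / (3 * lambda)) ^ 3 * (K * b ^ 2)).
  { apply Rmult_le_compat; try assumption; [apply Rlt_le, exp_pos|apply Rabs_pos]. }
  replace (/ (b / (3 * lambda)) ^ 3 * (K * b ^ 2)) with (27 * K * lambda ^ 3 / b)
    by (field; lra).
  apply Rlt_div_l; [lra|].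
  apply Rlt_div_l in Hb2; [lra|apply cond_pos].
Qed.

Section ExponentialMean.
Context {X : CompleteNormedModule R_AbsRing}.

Lemma is_RInt_gen_to_infinity {V : NormedModule R_AbsRing} (f : R -> V)
    (I : R -> V) (a : R) (l : V) :
  (forall b, a <= b -> is_RInt f a b (I b)) ->
  filterlim I (Rbar_locally p_infty) (locally l) ->
  is_RInt_gen f (at_point a) (Rbar_locally p_infty) l.
Proof.
  intros HI Hl P HP.
  destruct (Hl P HP) as [M HM].
  apply (Filter_prod _ _ _ (fun x => x = a) (fun b => Rmax M a < b)).
  - reflexivity.
  - now exists (Rmax M a).
  - intros x b -> Hb; exists (I b); split; simpl.
    + apply HI, Rlt_le, Rle_lt_trans with (2 := Hb), Rmax_r.
    + apply HM, Rle_lt_trans with (2 := Hb), Rmax_l.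
Qed.

(** The antiderivative [F] comes from integrating by parts twice. *)
Lemma is_RInt_exp_poly (lambda a b e x y : R) :
  0 < lambda ->
  is_RInt (fun tau => exp (- tau / lambda) * (a + b * tau + e * tau ^ 2)) x y
    (lambda * (exp (- x / lambda) * ((a + b * lambda + 2 * e * lambda ^ 2)
       + (b + 2 * e * lambda) * x + e * x ^ 2)
     - exp (- y / lambda) * ((a + b * lambda + 2 * e * lambda ^ 2)
       + (b + 2 * e * lambda) * y + e * y ^ 2))).
Proof.
  intros Hl.
  set (F := fun x => - lambda * (exp (- x / lambda) *
       ((a + b * lambda + 2 * e * lambda ^ 2) + (b + 2 * e * lambda) * x + e * x ^ 2))).
  replace (lambda * _) with (minus (F y) (F x)).
  2:{ unfold F, minus, plus, opp; simpl; ring. }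
  apply (is_RInt_derive (V := R_CompleteNormedModule) F).
  - intros z _; unfold F; auto_derive; [trivial|unfold Rdiv; field; lra].
  - intros z _.
    apply (ex_derive_continuous (K := R_AbsRing) (V := R_NormedModule)).
    auto_derive; trivial.
Qed.

(** The moments of the exponential law, up to the normalising factor [lambda]. They are the source
    of the constants [b * lambda] and [2 * e * lambda ^ 2] in all later estimates of means. *)
Lemma is_RInt_gen_exp_poly (lambda a b e : R) :
  0 < lambda ->
  is_RInt_gen (fun tau => exp (- tau / lambda) * (a + b * tau + e * tau ^ 2))
    (at_point 0) (Rbar_locally p_infty)
    (lambda * (a + b * lambda + 2 * e * lambda ^ 2)).
Proof.
  intros Hl.
  eapply is_RInt_gen_to_infinity; [intros y _; now apply is_RInt_exp_poly|].
  set (Q := a + b * lambda + 2 * e * lambda ^ 2).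
  replace (- 0 / lambda) with 0 by (field; lra); rewrite exp_0.
  replace (1 * (Q + (b + 2 * e * lambda) * 0 + e * 0 ^ 2)) with Q by ring.
  replace (lambda * Q) with (lambda * (Q - 0)) by ring.
  apply (filterlim_comp _ _ _ _ (fun z => lambda * (Q - z)) _ _ _
           (exp_decay lambda Q (b + 2 * e * lambda) e Hl)).
  apply (ex_derive_continuous (K := R_AbsRing) (V := R_NormedModule)
           (fun z => lambda * (Q - z)) 0).
  auto_derive; trivial.
Qed.

Lemma BUC_continuous (u : R -> X) (t : R) : BUC u -> continuous u t.
Proof.
  intros [_ Hu]; apply (proj2 (filterlim_locally u (u t))); intros eps.
  destruct (Hu eps) as [delta Hd]; exists delta; intros s Hs.
  apply (norm_compat1 (u t) (u s)), Hd, Hs.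
Qed.

Lemma BUC_bound (u : R -> X) : BUC u -> exists M, 0 <= M /\ forall t, norm (u t) <= M.
Proof.
  intros [[M HM] _]; exists M; split; [|exact HM].
  apply Rle_trans with (2 := HM 0), norm_ge_0.
Qed.

Lemma BUC_const (c : X) : BUC (fun _ => c).
Proof.
  split.
  - exists (norm c); intros _; apply Rle_refl.
  - intros eps; exists eps; intros s t _; rewrite norm_minus_self; apply cond_pos.
Qed.

(** Bracketed so that [yosida_dt lambda u t] is convertible to [scal (/ lambda) (minus (u t)
    (exp_mean lambda u t))]. *)
Definition exp_mean (lambda : R) (u : R -> X) (t : R) : X :=
  scal (/ lambda)
    (RInt_gen (fun tau => scal (exp (- tau / lambda)) (u (t - tau)))
       (at_point 0) (Rbar_locally p_infty)).

Lemma exp_integrand_continuous (lambda : R) (u : R -> X) (t z : R) :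
  BUC u -> continuous (fun tau => scal (exp (- tau / lambda)) (u (t - tau))) z.
Proof.
  intros Hu.
  apply (continuous_scal (fun tau => exp (- tau / lambda)) (fun tau => u (t - tau))).
  - apply (ex_derive_continuous (K := R_AbsRing) (V := R_NormedModule)
             (fun tau => exp (- tau / lambda)) z).
    auto_derive; trivial.
  - apply (continuous_comp (fun tau => t - tau) u).
    + apply (ex_derive_continuous (K := R_AbsRing) (V := R_NormedModule)
               (fun tau => t - tau) z).
      auto_derive; trivial.
    + now apply BUC_continuous.
Qed.

Lemma exp_integrand_RInt (lambda : R) (u : R -> X) (t a b : R) :
  BUC u -> ex_RInt (fun tau => scal (exp (- tau / lambda)) (u (t - tau))) a b.
Proof.
  intros Hu; apply ex_RInt_continuous; intros z _.
  now apply exp_integrand_continuous.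
Qed.

(** The integral of the weight times the constant [c] is explicit. With [c = zero] this bounds the
    tails of the integral, with general [c] its initial piece. *)
Lemma norm_RInt_exp_le (lambda : R) (u : R -> X) (t a b e : R) (c : X) :
  BUC u -> 0 < lambda -> a <= b ->
  (forall tau, a <= tau <= b -> norm (minus (u (t - tau)) c) <= e) ->
  norm (minus (RInt (fun tau => scal (exp (- tau / lambda)) (u (t - tau))) a b)
          (scal (lambda * (exp (- a / lambda) - exp (- b / lambda))) c))
    <= lambda * (exp (- a / lambda) - exp (- b / lambda)) * e.
Proof.
  intros Hu Hl Hab He.
  set (F := fun tau => scal (- lambda * exp (- tau / lambda)) c : X).
  assert (Hc : is_RInt (fun tau => scal (exp (- tau / lambda)) c) a b
                 (scal (lambda * (exp (- a / lambda) - exp (- b / lambda))) c)).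
  { replace (scal (lambda * _) c) with (minus (F b) (F a))
      by (unfold F; vec).
    apply (is_RInt_derive F).
    - intros z _.
      apply (is_derive_scal_l (fun tau => - lambda * exp (- tau / lambda)) z
               (exp (- z / lambda)) c).
      auto_derive; [trivial|unfold Rdiv; field; lra].
    - intros z _.
      apply (continuous_scal_l (fun tau => exp (- tau / lambda)) c z).
      apply (ex_derive_continuous (K := R_AbsRing) (V := R_NormedModule)
             (fun tau => exp (- tau / lambda)) z).
      auto_derive; trivial. }
  generalize (is_RInt_minus _ _ _ _ _ _
    (RInt_correct _ _ _ (exp_integrand_RInt lambda u t a b Hu)) Hc); intros Hd.
  generalize (is_RInt_exp_poly lambda e 0 0 a b Hl); intros Hg.
  refine (Rle_trans _ _ _ (norm_RInt_le _ _ _ _ _ _ Hab _ Hd Hg) _).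
  - intros tau Htau; simpl.
    replace (minus _ _) with (scal (exp (- tau / lambda)) (minus (u (t - tau)) c))
      by vec.
    rewrite norm_scal_eq, Rabs_pos_eq by (apply Rlt_le, exp_pos).
    apply Rmult_le_compat_l; [apply Rlt_le, exp_pos|].
    generalize (He tau Htau); lra.
  - right; ring.
Qed.

(** The integrals over [[0, b]] are Cauchy, the piece beyond [b] being at most
    [lambda * exp (- b / lambda) * M]. Only this existence gives the [RInt_gen] in [exp_mean] a
    meaning. *)
Lemma exp_mean_correct (lambda : R) (u : R -> X) (t : R) :
  BUC u -> 0 < lambda ->
  is_RInt_gen (fun tau => scal (exp (- tau / lambda)) (u (t - tau)))
    (at_point 0) (Rbar_locally p_infty) (scal lambda (exp_mean lambda u t)).
Proof.
  intros Hu Hl.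
  set (f := fun tau => scal (exp (- tau / lambda)) (u (t - tau)) : X).
  assert (Hex : ex_RInt_gen f (at_point 0) (Rbar_locally p_infty)).
  { destruct (BUC_bound u Hu) as [M [HM0 HM]].
    assert (Hcauchy : forall b b', 0 <= b <= b' ->
              norm (minus (RInt f 0 b') (RInt f 0 b)) <= lambda * exp (- b / lambda) * M).
    { intros b b' Hb.
      replace (minus _ _)
        with (minus (RInt f b b')
               (scal (lambda * (exp (- b / lambda) - exp (- b' / lambda))) (zero : X))).
      2:{ rewrite <- (RInt_Chasles f 0 b b'); try now apply exp_integrand_RInt.
          vec. }
      eapply Rle_trans; [apply (norm_RInt_exp_le lambda u t b b' M); auto|].
      - apply Hb.
      - intros tau _; apply Rle_trans with (2 := HM (t - tau)).
        right; f_equal; vec.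
      - apply Rmult_le_compat_r; [exact HM0|].
        apply Rmult_le_compat_l; [lra|].
        generalize (exp_pos (- b' / lambda)); lra. }
    destruct (proj1 (filterlim_locally_cauchy (F := Rbar_locally p_infty)
                       (fun b => RInt f 0 b))) as [l Hlim].
    - intros eps.
      generalize (exp_decay lambda (lambda * M) 0 0 Hl); intros Hdec.
      destruct (proj1 (filterlim_locally _ _) Hdec (pos_div_2 eps)) as [N HN].
      exists (fun b => Rmax N 0 < b); split; [now exists (Rmax N 0)|].
      assert (Hwlog : forall b b', Rmax N 0 < b -> b <= b' ->
                norm (minus (RInt f 0 b') (RInt f 0 b)) < eps).
      { intros b b' Hb Hbb.
        generalize (Rmax_l N 0) (Rmax_r N 0); intros HN1 HN2.
        apply Rle_lt_trans with (1 := Hcauchy b b' ltac:(lra)).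
        assert (HNb : Rabs (exp (- b / lambda) * (lambda * M + 0 * b + 0 * b ^ 2) + - 0)
                      < eps / 2) by (apply HN; lra).
        apply Rabs_def2 in HNb.
        generalize (cond_pos eps); lra. }
      intros b b' Hb Hb'; apply (norm_compat1 (RInt f 0 b) (RInt f 0 b')).
      destruct (Rle_or_lt b b') as [Hle|Hlt]; [now apply Hwlog|].
      eapply Rle_lt_trans; [right; apply norm_minus_sym|].
      apply Hwlog; [exact Hb'|lra].
    - exists l; apply is_RInt_gen_to_infinity with (2 := Hlim).
      intros b _; apply (RInt_correct f), exp_integrand_RInt, Hu. }
  unfold exp_mean.
  replace (scal lambda _) with (RInt_gen f (at_point 0) (Rbar_locally p_infty)).
  - apply RInt_gen_correct; auto; apply Proper_StrongProper; typeclasses eauto.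
  - unfold f; vec; field; lra.
Qed.

Lemma exp_mean_unique (lambda : R) (u : R -> X) (t : R) (l : X) :
  0 < lambda ->
  is_RInt_gen (fun tau => scal (exp (- tau / lambda)) (u (t - tau)))
    (at_point 0) (Rbar_locally p_infty) (scal lambda l) ->
  exp_mean lambda u t = l.
Proof.
  intros Hl H; unfold exp_mean; rewrite (is_RInt_gen_unique _ _ H).
  vec; field; lra.
Qed.

Lemma exp_mean_dist (lambda : R) (u v : R -> X) (t s a b e : R) :
  BUC u -> BUC v -> 0 < lambda ->
  (forall tau, 0 <= tau ->
     norm (minus (u (t - tau)) (v (s - tau))) <= a + b * tau + e * tau ^ 2) ->
  norm (minus (exp_mean lambda u t) (exp_mean lambda v s))
    <= a + b * lambda + 2 * e * lambda ^ 2.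
Proof.
  intros Hu Hv Hl H.
  assert (Hn : norm (minus (scal lambda (exp_mean lambda u t))
                           (scal lambda (exp_mean lambda v s)))
               <= lambda * (a + b * lambda + 2 * e * lambda ^ 2)).
  { eapply (RInt_gen_norm (Fa := at_point 0) (Fb := Rbar_locally p_infty)
              (fun tau => minus (scal (exp (- tau / lambda)) (u (t - tau)))
                            (scal (exp (- tau / lambda)) (v (s - tau))))
              (fun tau => exp (- tau / lambda) * (a + b * tau + e * tau ^ 2))).
    - apply (Filter_prod _ _ _ (fun x => x = 0) (fun b => 0 < b));
        [reflexivity|now exists 0|intros x y -> Hy; simpl; lra].
    - apply (Filter_prod _ _ _ (fun x => x = 0) (fun b => 0 < b));
        [reflexivity|now exists 0|intros x y -> Hy; simpl].
      intros tau Htau.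
      replace (minus _ _)
        with (scal (exp (- tau / lambda)) (minus (u (t - tau)) (v (s - tau)))) by vec.
      rewrite norm_scal_eq, Rabs_pos_eq by (apply Rlt_le, exp_pos).
      apply Rmult_le_compat_l; [apply Rlt_le, exp_pos|].
      now apply H.
    - exact (is_RInt_gen_minus _ _ _ _ (exp_mean_correct lambda u t Hu Hl)
               (exp_mean_correct lambda v s Hv Hl)).
    - now apply is_RInt_gen_exp_poly. }
  replace (minus (scal lambda _) _)
    with (scal lambda (minus (exp_mean lambda u t) (exp_mean lambda v s))) in Hn by vec.
  rewrite norm_scal_eq, Rabs_pos_eq in Hn by lra.
  now apply Rmult_le_reg_l in Hn.
Qed.

(** The exponential law has no memory: the part of the integral beyond [delta] is
    [exp (- delta / lambda)] times the mean at [t - delta]. On [[0, delta]] the function is replaced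
    by [c] at the cost [e]. *)
Lemma exp_mean_split (lambda delta e : R) (u : R -> X) (t : R) (c : X) :
  BUC u -> 0 < lambda -> 0 <= delta ->
  (forall tau, 0 <= tau <= delta -> norm (minus (u (t - tau)) c) <= e) ->
  norm (minus (exp_mean lambda u t)
     (plus (scal (exp (- delta / lambda)) (exp_mean lambda u (t - delta)))
           (scal (1 - exp (- delta / lambda)) c)))
  <= (1 - exp (- delta / lambda)) * e.
Proof.
  intros Hu Hl Hd He.
  set (q := exp (- delta / lambda)).
  set (f := fun tau => scal (exp (- tau / lambda)) (u (t - tau)) : X).
  assert (Htail : is_RInt_gen f (at_point delta) (Rbar_locally p_infty)
                    (scal q (scal lambda (exp_mean lambda u (t - delta))))).
  { generalize (is_RInt_gen_scal _ q _ (exp_mean_correct lambda u (t - delta) Hu Hl)).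
    intros Hg P HP.
    destruct (Hg P HP) as [Q S HQ [M HM] HQS].
    apply (Filter_prod _ _ _ (fun x => x = delta) (fun b => M + delta < b));
      [reflexivity|now exists (M + delta)|].
    intros x b -> Hb.
    destruct (HQS 0 (b - delta) HQ (HM (b - delta) ltac:(lra))) as [y [Hy HPy]].
    exists y; split; [|exact HPy]; simpl in Hy |- *.
    set (k := fun tau => scal q (scal (exp (- tau / lambda)) (u (t - delta - tau))) : X).
    apply is_RInt_ext with (fun tau => scal 1 (k (1 * tau + - delta))).
    - intros tau _; unfold k, f, q.
      replace (t - delta - (1 * tau + - delta)) with (t - tau) by ring.
      vec.
      rewrite Rmult_1_l, !Rmult_1_r, <- exp_plus; f_equal; field; lra.
    - apply (is_RInt_comp_lin k 1 (- delta) delta b y).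
      replace (1 * delta + - delta) with 0 by ring.
      replace (1 * b + - delta) with (b - delta) by ring.
      exact Hy. }
  assert (Hhead : is_RInt_gen f (at_point 0) (at_point delta) (RInt f 0 delta)).
  { apply is_RInt_gen_at_point, RInt_correct, exp_integrand_RInt, Hu. }
  generalize (is_RInt_gen_Chasles _ _ _ _ Hhead Htail); intros Hall.
  generalize (norm_RInt_exp_le lambda u t 0 delta e c Hu Hl Hd He); fold f q.
  replace (- 0 / lambda) with 0 by (field; lra); rewrite exp_0.
  intros Hn.
  rewrite (exp_mean_unique lambda u t
             (plus (scal (/ lambda) (RInt f 0 delta))
                   (scal q (exp_mean lambda u (t - delta))))) by
    (try assumption; replace (scal lambda _) with
       (plus (RInt f 0 delta) (scal q (scal lambda (exp_mean lambda u (t - delta)))))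
       by (vec; field; lra); exact Hall).
  replace (minus (plus _ _) _)
    with (scal (/ lambda) (minus (RInt f 0 delta) (scal (lambda * (1 - q)) c)))
    by (vec; field; lra).
  rewrite norm_scal_eq, Rabs_pos_eq by (apply Rlt_le, Rinv_0_lt_compat; lra).
  apply Rmult_le_reg_l with lambda; [exact Hl|].
  rewrite <- Rmult_assoc, Rinv_r, Rmult_1_l; lra.
Qed.

End ExponentialMean.

(** * Bounds for the sup norm *)

Section SupNorm.
Context {X : CompleteNormedModule R_AbsRing} {T : Type}.

Lemma sup_norm_le (f : T -> X) (M : R) :
  0 <= M -> (forall t, norm (f t) <= M) -> sup_norm f <= M.
Proof.
  intros HM H; unfold sup_norm, Lub_Rbar.
  destruct ex_lub_Rbar as [l [Hub Hl]]; simpl.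
  assert (Hle : Rbar_le l M) by (apply Hl; intros y [t ->]; apply H).
  (* For an empty [T] the least upper bound is [m_infty], which [real] sends to [0]; this case uses
     [0 <= M]. *)
  destruct l as [l| |]; simpl in *; tauto || lra.
Qed.

Lemma sup_norm_ge_0 (f : T -> X) : 0 <= sup_norm f.
Proof.
  unfold sup_norm, Lub_Rbar.
  destruct ex_lub_Rbar as [l [Hub Hl]]; simpl.
  destruct l as [l| |]; simpl; try lra.
  destruct (classic (exists t : T, True)) as [[t _]|Hn].
  - apply Rle_trans with (1 := norm_ge_0 (f t)).
    apply (Hub (norm (f t))); now exists t.
  - exfalso; apply (Hl m_infty); intros y [t _]; apply Hn; now exists t.
Qed.

Lemma dist_sup_le (f g : T -> X) (M : R) :
  0 <= M -> (forall t, norm (minus (f t) (g t)) <= M) -> dist_sup f g <= M.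
Proof. apply sup_norm_le. Qed.

End SupNorm.

(** * Contraction, regularisation and invariance under exponential means *)

Section ExponentialMeanProperties.
Context {X : CompleteNormedModule R_AbsRing}.
Implicit Types (u v : R -> X).

(** The mean [p] of a constant is independent of [t], so the splitting with error [0] reads
    [p = q p + (1 - q) c] with [q < 1]. *)
Lemma exp_mean_const (lambda : R) (c : X) (t : R) :
  0 < lambda -> exp_mean lambda (fun _ => c) t = c.
Proof.
  intros Hl.
  set (q := exp (- 1 / lambda)).
  assert (Hq : q < 1).
  { unfold q; rewrite <- exp_0; apply exp_increasing, Rlt_div_l; lra. }
  assert (Heq : exp_mean lambda (fun _ => c) t = exp_mean lambda (fun _ => c) (t - 1))
    by reflexivity.
  generalize (exp_mean_split lambda 1 0 (fun _ => c) t c (BUC_const c) Hl Rle_0_1); fold q.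
  rewrite <- Heq; clear Heq; set (p := exp_mean lambda (fun _ => c) t); intros Hs.
  apply eq_of_norm_minus.
  apply Rmult_le_reg_l with (1 - q); [lra|].
  rewrite Rmult_0_r; rewrite <- (Rabs_pos_eq (1 - q)) at 1 by lra.
  rewrite <- norm_scal_eq.
  replace (scal (1 - q) (minus p c))
    with (minus p (plus (scal q p) (scal (1 - q) c))) by vec.
  eapply Rle_trans; [apply Hs|lra].
  intros tau _; rewrite norm_minus_self; lra.
Qed.

Lemma exp_mean_near (lambda : R) u (t a b e : R) (c : X) :
  BUC u -> 0 < lambda ->
  (forall tau, 0 <= tau -> norm (minus (u (t - tau)) c) <= a + b * tau + e * tau ^ 2) ->
  norm (minus (exp_mean lambda u t) c) <= a + b * lambda + 2 * e * lambda ^ 2.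
Proof.
  intros Hu Hl H; rewrite <- (exp_mean_const lambda c t Hl).
  apply exp_mean_dist; auto using BUC_const.
Qed.

Lemma exp_mean_contract (lambda : R) u v (t s a : R) :
  BUC u -> BUC v -> 0 < lambda ->
  (forall tau, 0 <= tau -> norm (minus (u (t - tau)) (v (s - tau))) <= a) ->
  norm (minus (exp_mean lambda u t) (exp_mean lambda v s)) <= a.
Proof.
  intros Hu Hv Hl H.
  apply Rle_trans with (a + 0 * lambda + 2 * 0 * lambda ^ 2); [|right; ring].
  apply exp_mean_dist; auto.
  intros tau Htau; generalize (H tau Htau); lra.
Qed.

Lemma exp_mean_bound (lambda : R) u (M : R) :
  BUC u -> 0 < lambda -> (forall t, norm (u t) <= M) ->
  forall t, norm (exp_mean lambda u t) <= M.
Proof.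
  intros Hu Hl H t.
  assert (Hz : norm (minus (exp_mean lambda u t) (exp_mean lambda (fun _ => zero) t)) <= M).
  { apply exp_mean_contract; auto using BUC_const.
    intros tau _; apply Rle_trans with (2 := H (t - tau)).
    right; f_equal; vec. }
  rewrite exp_mean_const in Hz by exact Hl.
  apply Rle_trans with (2 := Hz); right; f_equal; vec.
Qed.

Lemma exp_mean_BUC (lambda : R) u : BUC u -> 0 < lambda -> BUC (exp_mean lambda u).
Proof.
  intros Hu Hl; split.
  - destruct (BUC_bound u Hu) as [M [_ HM]]; exists M.
    now apply exp_mean_bound.
  - intros eps; destruct (proj2 Hu (pos_div_2 eps)) as [delta Hd].
    exists delta; intros s t Hst.
    apply Rle_lt_trans with (eps / 2); [|generalize (cond_pos eps); lra].
    apply exp_mean_contract; auto; intros tau _.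
    apply Rlt_le, Hd; now replace (t - tau - (s - tau)) with (t - s) by ring.
Qed.

(** Splitting with [c] the mean at [t - delta] leaves an error [(1 - q) * (2 * M)], and
    [1 - q <= delta / lambda]. Means are thus Lipschitz for every [u] in [BUC]. *)
Lemma exp_mean_increment (lambda : R) u (M : R) :
  BUC u -> 0 < lambda -> (forall t, norm (u t) <= M) ->
  forall s t, norm (minus (exp_mean lambda u s) (exp_mean lambda u t))
                <= 2 * M / lambda * Rabs (s - t).
Proof.
  intros Hu Hl HM.
  assert (HM0 : 0 <= M) by (apply Rle_trans with (2 := HM 0), norm_ge_0).
  assert (Hwlog : forall t delta, 0 <= delta ->
            norm (minus (exp_mean lambda u t) (exp_mean lambda u (t - delta)))
              <= 2 * M / lambda * delta).
  { intros t delta Hd.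
    set (q := exp (- delta / lambda)).
    assert (Hq : 1 - q <= delta / lambda).
    { unfold q; generalize (exp_ineq1_le (- delta / lambda)).
      unfold Rdiv; lra. }
    generalize (exp_mean_split lambda delta (2 * M) u t
                  (exp_mean lambda u (t - delta)) Hu Hl Hd); fold q; intros Hs.
    replace (minus _ _) with
      (minus (exp_mean lambda u t)
         (plus (scal q (exp_mean lambda u (t - delta)))
               (scal (1 - q) (exp_mean lambda u (t - delta))))) by vec.
    eapply Rle_trans; [apply Hs|].
    - intros tau _; apply Rle_trans with (1 := norm_minus_le _ _).
      generalize (HM (t - tau)) (exp_mean_bound lambda u M Hu Hl HM (t - delta)); lra.
    - replace (2 * M / lambda * delta) with (delta / lambda * (2 * M)) by (field; lra).
      apply Rmult_le_compat_r; lra. }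
  intros s t; destruct (Rle_or_lt t s) as [H|H].
  - rewrite Rabs_pos_eq by lra.
    replace t with (s - (s - t)) at 1 by ring; apply Hwlog; lra.
  - rewrite norm_minus_sym, <- Rabs_Ropp, Rabs_pos_eq by lra.
    replace s with (t - - (s - t)) at 1 by ring; apply Hwlog; lra.
Qed.

(** Within [delta] the increment is below [eps]; beyond it the trivial bound [2 * M] is at most
    [C * (s - t) ^ 2] with [C = 2 * M / delta ^ 2]. *)
Lemma BUC_quadratic_modulus u (eps : R) :
  BUC u -> 0 < eps ->
  exists C, 0 <= C /\ forall s t, norm (minus (u s) (u t)) <= eps + C * (s - t) ^ 2.
Proof.
  intros Hu Heps.
  destruct (BUC_bound u Hu) as [M [HM0 HM]].
  destruct (proj2 Hu (mkposreal _ Heps)) as [delta Hd]; simpl in Hd.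
  assert (Hdp := cond_pos delta).
  assert (Hd2 : 0 < delta ^ 2) by nra.
  exists (2 * M / delta ^ 2).
  assert (HC : 0 <= 2 * M / delta ^ 2) by (apply Rdiv_le_0_compat; lra).
  split; [exact HC|].
  intros s t; destruct (Rlt_or_le (Rabs (s - t)) delta) as [H|H].
  - generalize (Hd t s H) (Rmult_le_pos _ _ HC (pow2_ge_0 (s - t))); lra.
  - apply Rle_trans with (2 * M).
    + apply Rle_trans with (1 := norm_minus_le _ _).
      generalize (HM s) (HM t); lra.
    + replace (2 * M) with (2 * M / delta ^ 2 * delta ^ 2) at 1 by (field; lra).
      apply Rle_trans with (2 * M / delta ^ 2 * (s - t) ^ 2); [|lra].
      apply Rmult_le_compat_l; [exact HC|].
      rewrite <- (pow2_abs (s - t)); apply pow_incr; lra.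
Qed.

(** A mean with small [lambda] is Lipschitz, and the quadratic modulus of [u] keeps it within
    [eps / 2 + 2 * C * lambda ^ 2] of [u]. *)
Lemma lipschitz_dense u (eps : R) :
  BUC u -> 0 < eps ->
  exists v, BUC v /\ lipschitz v /\ forall t, norm (minus (u t) (v t)) <= eps.
Proof.
  intros Hu Heps.
  destruct (BUC_bound u Hu) as [M [HM0 HM]].
  destruct (BUC_quadratic_modulus u (eps / 2) Hu ltac:(lra)) as [C [HC HuC]].
  assert (Hlam : exists lambda, 0 < lambda /\ 2 * C * lambda ^ 2 <= eps / 2).
  { exists (Rmin 1 (eps / (4 * (C + 1)))).
    assert (Hp : 0 < eps / (4 * (C + 1))) by (apply Rdiv_lt_0_compat; lra).
    assert (Hm : 0 < Rmin 1 (eps / (4 * (C + 1)))) by (apply Rmin_pos; lra).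
    split; [exact Hm|].
    apply Rle_trans with (2 * (C + 1) * (eps / (4 * (C + 1)))); [|right; field; lra].
    generalize (Rmin_l 1 (eps / (4 * (C + 1)))) (Rmin_r 1 (eps / (4 * (C + 1)))).
    set (l := Rmin 1 _) in *; intros H1 H2.
    assert (l ^ 2 <= l) by nra.
    apply Rle_trans with (2 * (C + 1) * l); [nra|].
    apply Rmult_le_compat_l; lra. }
  destruct Hlam as [lambda [Hl HlC]].
  exists (exp_mean lambda u); split; [now apply exp_mean_BUC|split].
  - exists (2 * M / lambda); now apply exp_mean_increment.
  - intros t; rewrite norm_minus_sym.
    apply Rle_trans with (eps / 2 + 0 * lambda + 2 * C * lambda ^ 2); [|lra].
    apply exp_mean_near; auto.
    intros tau _; apply Rle_trans with (1 := HuC _ _).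
    right; ring.
Qed.

(* The sum [S (n+1) t = (1 - q) u t + q S n (t - delta)] of translates of [u],
   with [q = exp (- delta / lambda)], is a Riemann sum of the exponential mean. *)
Lemma exp_mean_in_subspace (Y : (R -> X) -> Prop) (lambda : R) u :
  linear_subspace_BUC Y -> closed_in_BUC Y -> translation_invariant Y ->
  0 < lambda -> Y u -> Y (exp_mean lambda u).
Proof.
  intros [HYb [HY0 [HYp HYs]]] HYc HYt Hl Yu.
  assert (Hu := HYb u Yu).
  apply HYc; [now apply exp_mean_BUC|].
  intros eps; assert (Heps := cond_pos eps).
  destruct (BUC_bound u Hu) as [M [HM0 HM]].
  destruct (proj2 Hu (mkposreal (eps / 4) ltac:(lra))) as [delta Hd]; simpl in Hd.
  assert (Hdp := cond_pos delta).
  (* Halved because the splitting uses the closed interval [[0, h]], while the modulus holds at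
     distances strictly below [delta]. *)
  set (h := delta / 2).
  set (q := exp (- h / lambda)).
  assert (Hq0 : 0 < q) by apply exp_pos.
  assert (Hq1 : q < 1).
  { unfold q; rewrite <- exp_0; apply exp_increasing, Rlt_div_l; unfold h; lra. }
  (* Each stage takes a convex combination of the errors, so the part [eps / 4] does not accumulate
     while the initial error [M] is multiplied by [q]. *)
  assert (Hsum : forall n, exists S, Y S /\ forall t,
            norm (minus (exp_mean lambda u t) (S t)) <= eps / 4 + q ^ n * M).
  { induction n as [|n [S [YS HS]]].
    - exists (fun _ => zero); split; [exact HY0|]; intros t.
      apply Rle_trans with M; [|simpl; lra].
      apply Rle_trans with (2 := exp_mean_bound lambda u M Hu Hl HM t).
      right; f_equal; vec.
    - exists (fun t => plus (scal (1 - q) (u t)) (scal q (S (t + - h)))); split.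
      + apply (HYp (fun t => scal (1 - q) (u t))).
        * now apply HYs.
        * apply (HYs q (fun t => S (t + - h))).
          now apply (HYt (- h)).
      + intros t.
        replace (minus _ _) with
          (plus (minus (exp_mean lambda u t)
                   (plus (scal q (exp_mean lambda u (t - h))) (scal (1 - q) (u t))))
                (scal q (minus (exp_mean lambda u (t - h)) (S (t + - h))))) by vec.
        apply Rle_trans with ((1 - q) * (eps / 4) + q * (eps / 4 + q ^ n * M)).
        * eapply Rle_trans; [apply (@norm_triangle R_AbsRing X)|].
          apply Rplus_le_compat.
          -- apply exp_mean_split; auto; [unfold h; lra|].
             intros tau Htau; apply Rlt_le, Hd.
             replace (t - tau - t) with (- tau) by ring.
             rewrite Rabs_Ropp, Rabs_pos_eq by lra; unfold h in Htau; lra.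
          -- rewrite norm_scal_eq, Rabs_pos_eq by lra.
             apply Rmult_le_compat_l; [lra|apply HS].
        * right; simpl; ring. }
  destruct (pow_lt_1_zero q) with (y := eps / 4 / (M + 1)) as [N HN].
  { rewrite Rabs_pos_eq; lra. }
  { apply Rdiv_lt_0_compat; lra. }
  specialize (HN N (Nat.le_refl N)); rewrite Rabs_pos_eq in HN by (apply pow_le; lra).
  destruct (Hsum N) as [S [YS HS]]; exists S; split; [exact YS|].
  apply Rle_lt_trans with (eps / 2); [|lra].
  apply dist_sup_le; [lra|]; intros t; apply Rle_trans with (1 := HS t).
  apply Rlt_div_r in HN; [|lra].
  generalize (pow_lt q N Hq0); nra.
Qed.

End ExponentialMeanProperties.
(** * Subspaces of bounded uniformly continuous functions *)

Section BUCSubspaces.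
Context {X : CompleteNormedModule R_AbsRing}.
Implicit Types (u v : R -> X).

Lemma unif_continuous_of_quadratic u :
  (forall eps, 0 < eps -> exists C, 0 <= C /\
     forall s t, norm (minus (u s) (u t)) <= eps + C * (s - t) ^ 2) ->
  unif_continuous (fun t : R => t) u.
Proof.
  intros H eps; assert (Heps := cond_pos eps).
  destruct (H (eps / 2) ltac:(lra)) as [C [HC Hu]].
  assert (Hp : 0 < eps / (2 * (C + 1))) by (apply Rdiv_lt_0_compat; lra).
  assert (Hm : 0 < Rmin 1 (eps / (2 * (C + 1)))) by (apply Rmin_pos; lra).
  exists (mkposreal _ Hm); simpl; intros s t Hst.
  generalize (Rmin_l 1 (eps / (2 * (C + 1)))) (Rmin_r 1 (eps / (2 * (C + 1)))).
  intros H1 H2.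
  apply Rle_lt_trans with (1 := Hu t s).
  rewrite <- (pow2_abs (t - s)).
  assert (H0 := Rabs_pos (t - s)); set (r := Rabs (t - s)) in *.
  assert (Hr : (C + 1) * r < eps / 2).
  { apply Rlt_le_trans with ((C + 1) * (eps / (2 * (C + 1)))).
    - apply Rmult_lt_compat_l; lra.
    - right; field; lra. }
  nra.
Qed.

Lemma BUC_uniform_limit u :
  (forall eps, 0 < eps -> exists v, BUC v /\ forall t, norm (minus (u t) (v t)) <= eps) ->
  BUC u.
Proof.
  intros H; split.
  - destruct (H 1 Rlt_0_1) as [v [Hv Huv]].
    destruct (BUC_bound v Hv) as [M [_ HM]].
    exists (1 + M); intros t.
    apply Rle_trans with (1 := norm_le_minus _ (v t)).
    generalize (Huv t) (HM t); lra.
  - intros eps; assert (Heps := cond_pos eps).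
    destruct (H (eps / 4) ltac:(lra)) as [v [Hv Huv]].
    destruct (proj2 Hv (pos_div_2 eps)) as [delta Hd]; exists delta.
    intros s t Hst; specialize (Hd s t Hst); simpl in Hd.
    apply Rle_lt_trans with (1 := norm_minus_triangle _ (v t) _).
    generalize (norm_minus_triangle (v t) (v s) (u s)) (Huv t) (Huv s).
    rewrite (norm_minus_sym (v s)); lra.
Qed.

Lemma BUC_linear_subspace : linear_subspace_BUC (@BUC X).
Proof.
  split; [auto|split; [apply BUC_const|split]].
  - intros u v [[M HM] Hu] [[N HN] Hv]; split.
    + exists (M + N); intros t; eapply Rle_trans; [apply (@norm_triangle R_AbsRing X)|].
      generalize (HM t) (HN t); lra.
    + intros eps; destruct (Hu (pos_div_2 eps)) as [du Hdu].
      destruct (Hv (pos_div_2 eps)) as [dv Hdv].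
      assert (Hm : 0 < Rmin du dv) by (apply Rmin_pos; apply cond_pos).
      exists (mkposreal _ Hm); simpl; intros s t Hst.
      replace (minus _ _) with (plus (minus (u t) (u s)) (minus (v t) (v s))) by vec.
      eapply Rle_lt_trans; [apply (@norm_triangle R_AbsRing X)|].
      generalize (Hdu s t (Rlt_le_trans _ _ _ Hst (Rmin_l _ _)))
                 (Hdv s t (Rlt_le_trans _ _ _ Hst (Rmin_r _ _))); simpl.
      destruct eps; simpl; lra.
  - intros c u Hu; destruct (BUC_bound u Hu) as [M [_ HM]]; split.
    + exists (Rabs c * M); intros t; rewrite norm_scal_eq.
      apply Rmult_le_compat_l; [apply Rabs_pos|apply HM].
    + assert (Hc : 0 < Rabs c + 1) by (generalize (Rabs_pos c); lra).
      intros eps; assert (He : 0 < eps / (Rabs c + 1))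
        by (apply Rdiv_lt_0_compat; [apply cond_pos|exact Hc]).
      destruct (proj2 Hu (mkposreal _ He)) as [delta Hd]; simpl in Hd; exists delta.
      intros s t Hst; specialize (Hd s t Hst).
      replace (minus _ _) with (scal c (minus (u t) (u s))) by vec.
      rewrite norm_scal_eq.
      apply Rlt_div_r in Hd; [|exact Hc].
      generalize (norm_ge_0 (minus (u t) (u s))); lra.
Qed.

Lemma BUC_translation_invariant : translation_invariant (@BUC X).
Proof.
  intros a u [[M HM] Hu]; split; [now exists M; intros t|].
  intros eps; destruct (Hu eps) as [delta Hd]; exists delta; intros s t Hst.
  apply Hd; now replace (t + a - (s + a)) with (t - s) by ring.
Qed.

Lemma closed_uniform_limit (Y : (R -> X) -> Prop) u :
  (forall v, Y v -> BUC v) -> closed_in_BUC Y ->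
  (forall eps, 0 < eps -> exists v, Y v /\ forall t, norm (minus (u t) (v t)) <= eps) ->
  Y u.
Proof.
  intros HYb HYc H; apply HYc.
  - apply BUC_uniform_limit; intros eps Heps.
    destruct (H eps Heps) as [v [Yv Hv]]; exists v; auto.
  - intros eps; assert (Heps := cond_pos eps).
    destruct (H (eps / 2) ltac:(lra)) as [v [Yv Hv]]; exists v; split; [exact Yv|].
    apply Rle_lt_trans with (eps / 2); [|lra].
    apply dist_sup_le; [lra|exact Hv].
Qed.

Lemma lipschitz_BUC u : Defs.bounded u -> lipschitz u -> BUC u.
Proof.
  intros Hb [L HL]; split; [exact Hb|].
  assert (HL' : 0 < Rabs L + 1) by (generalize (Rabs_pos L); lra).
  intros eps; assert (He : 0 < eps / (Rabs L + 1))
    by (apply Rdiv_lt_0_compat; [apply cond_pos|exact HL']).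
  exists (mkposreal _ He); simpl; intros s t Hst.
  apply Rle_lt_trans with (1 := HL t s).
  apply Rlt_div_r in Hst; [|exact HL'].
  generalize (Rabs_pos (t - s)) (Rle_abs L); nra.
Qed.

Lemma lipschitz_constP u :
  lipschitz u ->
  0 <= lipschitz_const u /\
  forall s t, norm (minus (u s) (u t)) <= lipschitz_const u * Rabs (s - t).
Proof.
  intros [L HL].
  unfold lipschitz_const, Lub_Rbar.
  destruct ex_lub_Rbar as [l [Hub Hl]]; simpl.
  assert (HlL : Rbar_le l L).
  { apply Hl; intros q [s [t [Hst ->]]].
    apply Rle_div_l; [apply Rabs_pos_lt; lra|apply HL]. }
  (* A single quotient excludes [m_infty] and shows that the constant is non-negative. *)
  assert (H10 : Rbar_le (norm (minus (u 1) (u 0)) / Rabs (1 - 0)) l)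
    by (apply Hub; exists 1, 0; split; [lra|reflexivity]).
  destruct l as [l| |]; try (simpl in *; tauto).
  simpl; split.
  - apply Rle_trans with (2 := H10).
    apply Rdiv_le_0_compat; [apply norm_ge_0|apply Rabs_pos_lt; lra].
  - intros s t; destruct (Req_dec s t) as [->|Hst].
    + rewrite norm_minus_self, Rminus_diag, Rabs_R0; lra.
    + apply Rle_div_l; [apply Rabs_pos_lt; lra|].
      apply (Hub (norm (minus (u s) (u t)) / Rabs (s - t))); now exists s, t.
Qed.

Context {d : delay}.

Lemma in_E_history u (t : R) : BUC u -> in_E (@history X d u t).
Proof.
  intros [[M HM] Hu].
  assert (Huc : unif_continuous (@delay_pos d) (history u t)).
  { intros eps; destruct (Hu eps) as [delta Hd]; exists delta; intros s s' Hs.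
    apply Hd; now replace (t + delay_pos s' - (t + delay_pos s))
                with (delay_pos s' - delay_pos s) by ring. }
  destruct d; simpl.
  - split; [exists M; intros s; apply HM|exact Huc].
  - intros s eps; destruct (Huc eps) as [delta Hd]; exists delta; intros s'; apply Hd.
Qed.

Lemma dist_sup_history u v (t s eta : R) :
  0 <= eta ->
  (forall a, norm (minus (u (t + a)) (v (s + a))) <= eta) ->
  dist_sup (@history X d u t) (history v s) <= eta.
Proof. intros H0 H; apply dist_sup_le; [exact H0|intros a; apply H]. Qed.

End BUCSubspaces.
(** * The approximate equations *)

Section Evolution.
Context {X : CompleteNormedModule R_AbsRing} {d : delay}.
Variables (A : R -> (delay_interval d -> X) -> operator X) (omega : R).
Variables (g h k : R -> X) (K0 G : R) (L1 L2 : R -> R).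
Local Notation beta := (- omega).

Hypothesis A_dissipative : forall (t : R) (phi : delay_interval d -> X),
  in_E phi -> m_dissipative (A t phi).
Hypothesis h_BUC : BUC h.
Hypothesis k_BUC : BUC k.
Hypothesis g_bounded : Defs.bounded g.
Hypothesis g_lipschitz : forall s t, norm (minus (g s) (g t)) <= G * Rabs (s - t).
Hypothesis G_ge_0 : 0 <= G.
Hypothesis G_lt : G < beta.
Hypothesis K0_pos : 0 < K0.
Hypothesis K0_lt : K0 < beta.
Hypothesis L1_control : control_fun L1.
Hypothesis L2_control : control_fun L2.

(** The error of the control condition per unit of [lambda]. Here [z2] stands for an element of [A]
    itself, not of the operator shifted by [omega]. *)
Definition control_term (t1 t2 : R) (phi1 phi2 : delay_interval d -> X) (x2 z2 : X) : R :=
  norm (minus (h t1) (h t2)) * L1 (norm x2)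
  + norm (minus (g t1) (g t2)) * norm z2
  + norm (minus (k t1) (k t2)) * L2 (sup_norm phi2)
  + K0 * dist_sup phi1 phi2.

Hypothesis control : forall (lambda t1 t2 : R) (phi1 phi2 : delay_interval d -> X)
    (x1 z1 x2 z2 : X),
  0 < lambda -> in_E phi1 -> in_E phi2 -> A t1 phi1 x1 z1 -> A t2 phi2 x2 z2 ->
  norm (minus x1 x2)
    <= norm (minus (minus x1 x2) (scal lambda (minus z1 z2)))
       + lambda * control_term t1 t2 phi1 phi2 x2 z2.

(** The resolvent equation with the element [z] of [A] kept visible, since the control condition
    involves its norm. *)
Definition resolves (lambda : R) (x z f : X) : Prop :=
  f = minus x (scal lambda (plus z (scal omega x))).

(** The control condition with step [lambda / (1 + lambda * beta)]: multiplied by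
    [1 + lambda * beta], the vector inside its first norm on the right is exactly [f1 - f2]. *)
Lemma shifted_control (lambda t1 t2 : R) (phi1 phi2 : delay_interval d -> X)
    (x1 z1 f1 x2 z2 f2 : X) :
  0 < lambda -> in_E phi1 -> in_E phi2 -> A t1 phi1 x1 z1 -> A t2 phi2 x2 z2 ->
  resolves lambda x1 z1 f1 -> resolves lambda x2 z2 f2 ->
  (1 + lambda * beta) * norm (minus x1 x2)
    <= norm (minus f1 f2) + lambda * control_term t1 t2 phi1 phi2 x2 z2.
Proof.
  intros Hl E1 E2 A1 A2 -> ->.
  assert (Hlb : 0 < 1 + lambda * beta) by nra.
  generalize (control (lambda / (1 + lambda * beta)) t1 t2 phi1 phi2 x1 z1 x2 z2
                (Rdiv_lt_0_compat _ _ Hl Hlb) E1 E2 A1 A2).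
  set (T := control_term _ _ _ _ _ _); intros H.
  apply Rmult_le_compat_l with (r := 1 + lambda * beta) in H; [|lra].
  apply Rle_trans with (1 := H).
  rewrite Rmult_plus_distr_l.
  rewrite <- (Rabs_pos_eq (1 + lambda * beta)) at 1 by lra.
  rewrite <- norm_scal_eq.
  apply Rplus_le_compat; right.
  - f_equal; vec; field; lra.
  - field; lra.
Qed.

(* The control condition with step [lambda mu / (lambda + mu)]. *)
Lemma two_step_control (lambda mu t1 t2 : R) (phi1 phi2 : delay_interval d -> X)
    (x1 z1 f1 x2 z2 f2 : X) :
  0 < lambda -> 0 < mu ->
  in_E phi1 -> in_E phi2 -> A t1 phi1 x1 z1 -> A t2 phi2 x2 z2 ->
  resolves lambda x1 z1 f1 -> resolves mu x2 z2 f2 ->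
  (lambda + mu + lambda * mu * beta) * norm (minus x1 x2)
    <= lambda * norm (minus f2 x1) + mu * norm (minus f1 x2)
       + lambda * mu * control_term t1 t2 phi1 phi2 x2 z2.
Proof.
  intros Hl Hm E1 E2 A1 A2 H1 H2.
  set (rho := lambda * mu / (lambda + mu)).
  assert (Hr : 0 < rho) by (apply Rdiv_lt_0_compat; nra).
  generalize (shifted_control rho t1 t2 phi1 phi2 x1 z1 _ x2 z2 _ Hr E1 E2 A1 A2
                eq_refl eq_refl).
  set (T := control_term _ _ _ _ _ _); intros H.
  apply Rmult_le_compat_l with (r := lambda + mu) in H; [|lra].
  replace (lambda + mu + lambda * mu * beta) with ((lambda + mu) * (1 + rho * beta))
    by (unfold rho; field; lra).
  rewrite Rmult_assoc; apply Rle_trans with (1 := H).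
  rewrite Rmult_plus_distr_l.
  apply Rplus_le_compat; [|right; unfold rho; field; lra].
  rewrite <- (Rabs_pos_eq (lambda + mu)) at 1 by lra.
  rewrite <- norm_scal_eq.
  (* For this [rho] the terms in [z1], [z2] agree on both sides, and only mixed differences remain:
     the data of one equation against the solution of the other. *)
  replace (scal (lambda + mu) _)
    with (minus (scal mu (minus f1 x2)) (scal lambda (minus f2 x1))).
  - apply Rle_trans with (1 := norm_minus_le _ _).
    rewrite !norm_scal_eq, !Rabs_pos_eq by lra; lra.
  - rewrite H1, H2; unfold rho; vec; field; lra.
Qed.

Lemma control_term_same_time (t eta : R) (psi1 psi2 : R -> X) (x2 z2 : X) :
  0 <= eta -> (forall a, norm (minus (psi1 a) (psi2 a)) <= eta) ->
  control_term t t (history psi1 t) (history psi2 t) x2 z2 <= K0 * eta.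
Proof.
  intros H0 H; unfold control_term; rewrite !norm_minus_self, !Rmult_0_l, !Rplus_0_l.
  apply Rmult_le_compat_l; [lra|].
  apply dist_sup_history; [exact H0|intros a; apply H].
Qed.

Lemma L1_le (x y : R) : 0 <= x <= y -> 0 <= L1 x <= L1 y.
Proof. destruct L1_control as [H0 [_ Hm]]; intros H; split; [now apply H0|now apply Hm]. Qed.

Lemma L2_le (x y : R) : 0 <= x <= y -> 0 <= L2 x <= L2 y.
Proof. destruct L2_control as [H0 [_ Hm]]; intros H; split; [now apply H0|now apply Hm]. Qed.

(** The bound is imposed on the product [G * norm z2]: for [G = 0] it holds with [a = 0] whatever
    [z2] is. *)
Lemma control_term_le (t s N M eta a : R) (psi1 psi2 : R -> X) (x2 z2 : X) :
  0 <= eta -> 0 <= M -> norm x2 <= N -> (forall b, norm (psi2 b) <= M) ->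
  G * norm z2 <= a ->
  (forall b, norm (minus (psi1 (t + b)) (psi2 (s + b))) <= eta) ->
  control_term t s (history psi1 t) (history psi2 s) x2 z2
    <= norm (minus (h t) (h s)) * L1 N + a * Rabs (t - s)
       + norm (minus (k t) (k s)) * L2 M + K0 * eta.
Proof.
  intros Heta HM Hx Hpsi Hz H; unfold control_term.
  assert (Hx0 := norm_ge_0 x2).
  assert (Hs : sup_norm (history psi2 s : delay_interval d -> X) <= M)
    by (apply sup_norm_le; [exact HM|intros b; apply Hpsi]).
  assert (Hs0 := sup_norm_ge_0 (history psi2 s : delay_interval d -> X)).
  repeat apply Rplus_le_compat.
  - apply Rmult_le_compat_l; [apply norm_ge_0|now apply L1_le].
  - apply Rle_trans with (G * Rabs (t - s) * norm z2).
    + apply Rmult_le_compat_r; [apply norm_ge_0|apply g_lipschitz].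
    + generalize (Rabs_pos (t - s)); nra.
  - apply Rmult_le_compat_l; [apply norm_ge_0|now apply L2_le].
  - apply Rmult_le_compat_l; [lra|now apply dist_sup_history].
Qed.

(** The moduli of [h] and [k] are quadratic up to small constants, and the linear term is absorbed
    by [a * r <= eps / 4 + a ^ 2 / eps * r ^ 2]. The constant [C] depends on bounds only, hence not
    on [lambda] once these are uniform. *)
Lemma control_term_quadratic (N M a eps : R) :
  0 <= N -> 0 <= M -> 0 < eps ->
  exists C, 0 <= C /\ forall (t s eta : R) (psi1 psi2 : R -> X) (x2 z2 : X),
    0 <= eta -> norm x2 <= N -> (forall b, norm (psi2 b) <= M) -> G * norm z2 <= a ->
    (forall b, norm (minus (psi1 (t + b)) (psi2 (s + b))) <= eta) ->
    control_term t s (history psi1 t) (history psi2 s) x2 z2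
      <= eps + C * (t - s) ^ 2 + K0 * eta.
Proof.
  intros HN HM Heps.
  assert (HL1 : 0 <= L1 N) by (apply (L1_le N N); lra).
  assert (HL2 : 0 <= L2 M) by (apply (L2_le M M); lra).
  destruct (BUC_quadratic_modulus h (eps / (4 * (L1 N + 1))) h_BUC) as [Ch [HCh Hh]];
    [apply Rdiv_lt_0_compat; lra|].
  destruct (BUC_quadratic_modulus k (eps / (4 * (L2 M + 1))) k_BUC) as [Ck [HCk Hk]];
    [apply Rdiv_lt_0_compat; lra|].
  assert (Ha : 0 <= a ^ 2 / eps) by (apply Rdiv_le_0_compat; [apply pow2_ge_0|lra]).
  exists (Ch * L1 N + a ^ 2 / eps + Ck * L2 M); split; [nra|].
  intros t s eta psi1 psi2 x2 z2 Heta Hx Hpsi Hz H.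
  apply Rle_trans with (1 := control_term_le t s N M eta a psi1 psi2 x2 z2 Heta HM Hx Hpsi Hz H).
  assert (Hmod : forall e L, 0 <= L -> 0 < e -> e / (4 * (L + 1)) * L <= e / 4).
  { intros e L HL He; replace (e / (4 * (L + 1)) * L) with (e / 4 * (L / (L + 1)))
      by (field; lra).
    rewrite <- (Rmult_1_r (e / 4)) at 2; apply Rmult_le_compat_l; [lra|].
    apply Rle_div_l; lra. }
  assert (E1 : norm (minus (h t) (h s)) * L1 N <= eps / 4 + Ch * L1 N * (t - s) ^ 2).
  { apply Rle_trans with (1 := Rmult_le_compat_r _ _ _ HL1 (Hh t s)).
    generalize (Hmod eps (L1 N) HL1 Heps); lra. }
  assert (E2 : norm (minus (k t) (k s)) * L2 M <= eps / 4 + Ck * L2 M * (t - s) ^ 2).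
  { apply Rle_trans with (1 := Rmult_le_compat_r _ _ _ HL2 (Hk t s)).
    generalize (Hmod eps (L2 M) HL2 Heps); lra. }
  assert (E3 : a * Rabs (t - s) <= eps / 4 + a ^ 2 / eps * (t - s) ^ 2).
  { rewrite <- (pow2_abs (t - s)); set (r := Rabs (t - s)).
    apply Rminus_le; replace (a * r - _) with (- ((a * r - eps / 2) ^ 2 / eps))
      by (field; lra).
    assert (0 <= (a * r - eps / 2) ^ 2 / eps)
      by (apply Rdiv_le_0_compat; [apply pow2_ge_0|lra]).
    lra. }
  lra.
Qed.

(** Existence is the range condition with step [lambda / (1 + lambda * beta)] at
    [f / (1 + lambda * beta)]; uniqueness is the control condition at equal times and histories.
    Together they give the [iota] in [resolvent] its meaning. *)
Lemma J_correct (lambda t : R) (psi : R -> X) (f : X) :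
  0 < lambda -> BUC psi ->
  exists z, A t (history psi t) (J A omega lambda t (history psi t) f) z /\
    resolves lambda (J A omega lambda t (history psi t) f) z f.
Proof.
  intros Hl Hpsi.
  assert (HE := in_E_history (d := d) psi t Hpsi).
  assert (Hlb : 0 < 1 + lambda * beta) by nra.
  destruct (A_dissipative t (history psi t) HE) as [_ Hrange].
  assert (Hex : exists! x : X, exists y, op_shift (A t (history psi t)) omega x y /\
                  f = minus x (scal lambda y)).
  { destruct (Hrange (lambda / (1 + lambda * beta)) (Rdiv_lt_0_compat _ _ Hl Hlb)
                (scal (/ (1 + lambda * beta)) f)) as [x [z [Az Hz]]].
    assert (Hf : resolves lambda x z f).
    { unfold resolves.
      replace f with (scal (1 + lambda * beta) (scal (/ (1 + lambda * beta)) f))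
        by (vec; field; lra).
      rewrite Hz; vec; field; lra. }
    exists x; split.
    - exists (plus z (scal omega x)); split; [now exists z|exact Hf].
    - intros x' [y' [[z' [Az' ->]] Hf']].
      apply eq_of_norm_minus.
      apply Rmult_le_reg_l with (1 + lambda * beta); [exact Hlb|].
      apply Rle_trans with
        (1 := shifted_control lambda t t _ _ x z f x' z' f Hl HE HE Az Az' Hf Hf').
      rewrite norm_minus_self, Rmult_0_r, Rplus_0_l.
      replace 0 with (lambda * (K0 * 0)) by ring.
      apply Rmult_le_compat_l; [lra|].
      apply control_term_same_time; [lra|].
      intros a; rewrite norm_minus_self; lra. }
  destruct (iota_correct _ Hex) as [y [[z [Az ->]] Hf]].
  now exists z.
Qed.

(** Comparison with one fixed element [[x0, z0]] of [A] at time [0] and zero history: the control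
    terms then contain only [x0], [z0] and bounded data, so [C] is independent of [lambda], [t] and
    [psi]. *)
Lemma resolvent_bound :
  exists (x0 : X) (C : R), 0 <= C /\ forall (lambda t M : R) (psi : R -> X) (x z f : X),
    0 < lambda -> BUC psi -> 0 <= M -> (forall a, norm (psi a) <= M) ->
    A t (history psi t) x z -> resolves lambda x z f ->
    (1 + lambda * beta) * norm (minus x x0)
      <= norm (minus f x0) + lambda * (C + K0 * M).
Proof.
  assert (HE0 := in_E_history (d := d) (fun _ => zero) 0 (BUC_const (zero : X))).
  destruct (A_dissipative 0 _ HE0) as [_ Hrange].
  destruct (Hrange 1 Rlt_0_1 zero) as [x0 [z0 [A0 _]]]; exists x0.
  destruct (BUC_bound h h_BUC) as [Mh [HMh0 HMh]].
  destruct (BUC_bound k k_BUC) as [Mk [HMk0 HMk]].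
  destruct g_bounded as [Mg HMg].
  assert (HMg0 : 0 <= Mg) by (apply Rle_trans with (2 := HMg 0), norm_ge_0).
  assert (HL1 : 0 <= L1 (norm x0))
    by (apply (L1_le _ (norm x0)); split; [apply norm_ge_0|lra]).
  assert (HL2 : 0 <= L2 0) by (apply (L2_le 0 0); lra).
  set (C := norm (plus z0 (scal omega x0)) + 2 * Mh * L1 (norm x0)
            + 2 * Mg * norm z0 + 2 * Mk * L2 0).
  assert (Hz0 := norm_ge_0 z0).
  assert (Hy0 := norm_ge_0 (plus z0 (scal omega x0))).
  exists C; split; [unfold C; nra|].
  intros lambda t M psi x z f Hl Hpsi HM HpsiM Axz Hf.
  apply Rle_trans with
    (1 := shifted_control lambda t 0 _ _ x z f x0 z0 _ Hl
            (in_E_history psi t Hpsi) HE0 Axz A0 Hf eq_refl).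
  assert (Hterm : control_term t 0 (history psi t) (history (fun _ => zero) 0) x0 z0
                  <= 2 * Mh * L1 (norm x0) + 2 * Mg * norm z0 + 2 * Mk * L2 0 + K0 * M).
  { unfold control_term; repeat apply Rplus_le_compat.
    - apply Rmult_le_compat_r; [exact HL1|].
      apply Rle_trans with (1 := norm_minus_le _ _); generalize (HMh t) (HMh 0); lra.
    - apply Rmult_le_compat_r; [exact Hz0|].
      apply Rle_trans with (1 := norm_minus_le _ _); generalize (HMg t) (HMg 0); lra.
    - assert (Hs : 0 <= sup_norm (history (fun _ => zero : X) 0 : delay_interval d -> X) <= 0).
      { split; [apply sup_norm_ge_0|apply sup_norm_le; [lra|]].
        intros a; right; exact norm_zero. }
      apply Rmult_le_compat; [apply norm_ge_0|now apply (L2_le _ _ Hs)| |now apply L2_le].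
      apply Rle_trans with (1 := norm_minus_le _ _); generalize (HMk t) (HMk 0); lra.
    - apply Rmult_le_compat_l; [lra|].
      apply (dist_sup_history psi (fun _ => zero)); [exact HM|]; intros a.
      apply Rle_trans with (2 := HpsiM (t + a)); right; f_equal; vec. }
  replace (minus f _) with (plus (minus f x0) (scal lambda (plus z0 (scal omega x0)))) by vec.
  apply Rle_trans with (norm (minus f x0) + lambda * norm (plus z0 (scal omega x0))
    + lambda * control_term t 0 (history psi t) (history (fun _ => zero) 0) x0 z0).
  - apply Rplus_le_compat_r.
    eapply Rle_trans; [apply (@norm_triangle R_AbsRing X)|].
    rewrite norm_scal_eq, Rabs_pos_eq by lra; lra.
  - unfold C; nra.
Qed.

Lemma J_contract (lambda t : R) (psi : R -> X) (f1 f2 : X) :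
  0 < lambda -> BUC psi ->
  norm (minus (J A omega lambda t (history psi t) f1) (J A omega lambda t (history psi t) f2))
    <= / (1 + lambda * beta) * norm (minus f1 f2).
Proof.
  intros Hl Hpsi.
  assert (Hlb : 0 < 1 + lambda * beta) by nra.
  destruct (J_correct lambda t psi f1 Hl Hpsi) as [z1 [A1 R1]].
  destruct (J_correct lambda t psi f2 Hl Hpsi) as [z2 [A2 R2]].
  assert (HE := in_E_history (d := d) psi t Hpsi).
  generalize (shifted_control lambda t t _ _ _ _ _ _ _ _ Hl HE HE A1 A2 R1 R2).
  assert (H0 : control_term t t (history psi t) (history psi t)
                 (J A omega lambda t (history psi t) f2) z2 <= K0 * 0).
  { apply control_term_same_time; [lra|]; intros a; rewrite norm_minus_self; lra. }
  intros H; apply Rmult_le_reg_l with (1 + lambda * beta); [exact Hlb|].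
  rewrite <- Rmult_assoc, Rinv_r, Rmult_1_l by lra; nra.
Qed.

(** A crude bound that degenerates as [lambda] tends to [0]; it serves at fixed [lambda], where only
    finiteness matters. *)
Lemma resolves_norm_le (lambda : R) (x z f : X) :
  0 < lambda -> resolves lambda x z f ->
  norm z <= (norm x + norm f) / lambda + beta * norm x.
Proof.
  intros Hl Hf.
  replace z with (minus (scal (/ lambda) (minus x f)) (scal omega x))
    by (rewrite Hf; vec; field; lra).
  apply Rle_trans with (1 := norm_minus_le _ _).
  rewrite !norm_scal_eq, (Rabs_pos_eq (/ lambda)), (Rabs_left omega)
    by (lra || (apply Rlt_le, Rinv_0_lt_compat; lra)).
  apply Rplus_le_compat_r; unfold Rdiv; rewrite Rmult_comm.
  apply Rmult_le_compat_r; [apply Rlt_le, Rinv_0_lt_compat; lra|apply norm_minus_le].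
Qed.

(** Makes [BUC] itself an admissible [Y], so that one fixed point argument yields solutions both in
    [BUC] and in [Y]. *)
Lemma J_BUC (lambda : R) (psi f : R -> X) :
  0 < lambda -> BUC psi -> BUC f ->
  BUC (fun t => J A omega lambda t (history psi t) (f t)).
Proof.
  intros Hl Hpsi Hf.
  assert (Hlb : 0 < lambda * beta) by nra.
  destruct (BUC_bound psi Hpsi) as [M [HM0 HM]].
  destruct (BUC_bound f Hf) as [Mf [HMf0 HMf]].
  destruct resolvent_bound as [x0 [C [HC Hres]]].
  assert (Hx0 := norm_ge_0 x0).
  set (N := Mf + norm x0 + lambda * (C + K0 * M) + norm x0).
  assert (HN0 : 0 <= lambda * (C + K0 * M)) by (apply Rmult_le_pos; nra).
  assert (HN : forall t, norm (J A omega lambda t (history psi t) (f t)) <= N).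
  { intros t; destruct (J_correct lambda t psi (f t) Hl Hpsi) as [z [Az Rz]].
    generalize (Hres lambda t M psi _ _ _ Hl Hpsi HM0 HM Az Rz).
    generalize (norm_minus_le (f t) x0) (HMf t).
    generalize (norm_le_minus (J A omega lambda t (history psi t) (f t)) x0).
    set (n := norm (minus _ x0)); assert (Hn : 0 <= n) by apply norm_ge_0.
    unfold N; nra. }
  assert (HN1 : 0 <= N) by (unfold N; lra).
  split; [now exists N|].
  set (a := G * ((N + Mf) / lambda + beta * N)).
  apply unif_continuous_of_quadratic; intros eps Heps.
  (* The shares are [eps / 2] from [f], [lambda * eps * beta / 4] from the control term and
     [lambda * K0 * eps / 8] from [psi]; since [K0 < beta] they total at most
     [(1 + lambda * beta) * eps]. *)
  assert (Heb : 0 < eps * beta / 4) by nra.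
  destruct (BUC_quadratic_modulus f (eps / 2) Hf ltac:(lra)) as [Cf [HCf Hfq]].
  destruct (BUC_quadratic_modulus psi (eps / 8) Hpsi ltac:(lra)) as [Cp [HCp Hpq]].
  destruct (control_term_quadratic N M a (eps * beta / 4) HN1 HM0 Heb) as [Cq [HCq Hq]].
  assert (HC0 : 0 <= Cf + lambda * (Cq + K0 * Cp)).
  { assert (0 <= K0 * Cp) by (apply Rmult_le_pos; lra).
    assert (0 <= lambda * (Cq + K0 * Cp)) by (apply Rmult_le_pos; lra).
    lra. }
  exists (Cf + lambda * (Cq + K0 * Cp)); split; [exact HC0|].
  intros s t.
  destruct (J_correct lambda s psi (f s) Hl Hpsi) as [z1 [A1 R1]].
  destruct (J_correct lambda t psi (f t) Hl Hpsi) as [z2 [A2 R2]].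
  generalize (shifted_control lambda s t _ _ _ _ _ _ _ _ Hl
    (in_E_history psi s Hpsi) (in_E_history psi t Hpsi) A1 A2 R1 R2).
  assert (Hd2 := pow2_ge_0 (s - t)).
  assert (Hterm : control_term s t (history psi s) (history psi t)
                    (J A omega lambda t (history psi t) (f t)) z2
                  <= eps * beta / 4 + Cq * (s - t) ^ 2
                     + K0 * (eps / 8 + Cp * (s - t) ^ 2)).
  { apply Hq; [nra|apply HN|exact HM| |].
    - apply Rmult_le_compat_l; [exact G_ge_0|].
      apply Rle_trans with (1 := resolves_norm_le lambda _ _ _ Hl R2).
      apply Rplus_le_compat; [|apply Rmult_le_compat_l; [lra|apply HN]].
      apply Rmult_le_compat_r; [apply Rlt_le, Rinv_0_lt_compat; lra|].
      apply Rplus_le_compat; [apply HN|apply HMf].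
    - intros b; apply Rle_trans with (1 := Hpq _ _); right.
      replace (s + b - (t + b)) with (s - t) by ring; reflexivity. }
  generalize (Hfq s t) (norm_ge_0 (minus (J A omega lambda s (history psi s) (f s))
                            (J A omega lambda t (history psi t) (f t)))).
  set (n := norm (minus (J A omega lambda s _ _) _)).
  intros Hfst Hn H.
  assert (HlT := Rmult_le_compat_l lambda _ _ (Rlt_le _ _ Hl) Hterm).
  assert (Hmain : (1 + lambda * beta) * n <= (1 + lambda * beta) * eps
                    + (Cf + lambda * (Cq + K0 * Cp)) * (s - t) ^ 2).
  { assert (K0 * (eps / 8) <= beta * (eps / 8)) by (apply Rmult_le_compat_r; lra).
    assert (lambda * (K0 * (eps / 8)) <= lambda * (beta * (eps / 8)))
      by (apply Rmult_le_compat_l; lra).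
    nra. }
  set (D := (Cf + lambda * (Cq + K0 * Cp)) * (s - t) ^ 2) in *.
  assert (HD : 0 <= D) by (apply Rmult_le_pos; [exact HC0|exact Hd2]).
  apply Rmult_le_reg_l with (1 + lambda * beta); nra.
Qed.

(** * Solutions of the approximate equation: existence, stability, bounds *)

Definition solves (lambda : R) (psi v : R -> X) : Prop :=
  BUC v /\ forall t, exists z, A t (history psi t) (v t) z /\
    resolves lambda (v t) z (exp_mean lambda v t).

Lemma approx_solution_iff (lambda : R) (psi v : R -> X) :
  0 < lambda -> (approx_solution A omega lambda psi v <-> solves lambda psi v).
Proof.
  intros Hl.
  assert (Hy : forall t, yosida_dt lambda v t
                 = scal (/ lambda) (minus (v t) (exp_mean lambda v t))) by reflexivity.
  split; intros [Hv H]; (split; [exact Hv|]); intros t;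
    destruct (H t) as [z [Az Hz]]; exists z; (split; [exact Az|]).
  - unfold resolves; rewrite <- Hz, Hy; vec; field; lra.
  - rewrite Hy, Hz; vec; field; lra.
Qed.

Lemma solves_exists (Y : (R -> X) -> Prop) (lambda : R) (psi : R -> X) :
  linear_subspace_BUC Y -> closed_in_BUC Y -> translation_invariant Y ->
  (forall psi f, Y psi -> Y f -> Y (fun t => J A omega lambda t (history psi t) (f t))) ->
  0 < lambda -> Y psi -> exists v, Y v /\ solves lambda psi v.
Proof.
  intros HYl HYc HYt HYJ Hl Ypsi.
  assert (HYb := proj1 HYl).
  assert (Hpsi := HYb _ Ypsi).
  set (F := fun w t => J A omega lambda t (history psi t) (exp_mean lambda w t)).
  assert (YF : forall w, Y w -> Y (F w)).
  { intros w Yw; apply HYJ; [exact Ypsi|now apply exp_mean_in_subspace]. }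
  assert (Hlb : 0 < lambda * beta) by nra.
  set (q := / (1 + lambda * beta)).
  assert (Hq : 0 < q < 1).
  { unfold q; split; [apply Rinv_0_lt_compat; lra|].
    rewrite <- Rinv_1; apply Rinv_lt_contravar; lra. }
  assert (HF : forall w1 w2 a, BUC w1 -> BUC w2 ->
            (forall t, norm (minus (w1 t) (w2 t)) <= a) ->
            forall t, norm (minus (F w1 t) (F w2 t)) <= q * a).
  { intros w1 w2 a H1 H2 H t.
    apply Rle_trans with (1 := J_contract _ _ _ _ _ Hl Hpsi).
    apply Rmult_le_compat_l; [apply Rlt_le, Hq|].
    apply exp_mean_contract; auto. }
  set (w := fun n => Nat.iter n F (fun _ => zero)).
  assert (Yw : forall n, Y (w n)).
  { induction n as [|n IH]; [apply HYl|now apply YF]. }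
  destruct (BUC_bound (w 1%nat) (HYb _ (Yw 1%nat))) as [M [HM0 HM]].
  assert (Hgeo : forall n t, norm (minus (w (S n) t) (w n t)) <= M * q ^ n).
  { induction n as [|n IH]; intros t.
    - rewrite pow_O, Rmult_1_r; apply Rle_trans with (2 := HM t).
      right; f_equal; change (w O t) with (zero : X); vec.
    - replace (M * q ^ S n) with (q * (M * q ^ n)) by (simpl; ring).
      apply (HF (w (S n)) (w n)); auto. }
  destruct (geometric_limit w q M ltac:(lra) Hgeo) as [v Hv].
  assert (Yv : Y v).
  { apply closed_uniform_limit; auto; intros eps Heps.
    destruct (Hv eps Heps) as [n Hn]; exists (w n); split; [apply Yw|].
    intros t; rewrite norm_minus_sym; now apply Hn. }
  exists v; split; [exact Yv|split; [now apply HYb|]]; intros t.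
  assert (Hfix : v t = F v t).
  { apply eq_of_norm_minus, le_of_le_eps; intros eps Heps.
    destruct (Hv (eps / 2) ltac:(lra)) as [n Hn].
    apply Rle_trans with (1 := norm_minus_triangle _ (w (S n) t) _).
    assert (H1 : norm (minus (v t) (w (S n) t)) <= eps / 2)
      by (rewrite norm_minus_sym; apply Hn; lia).
    assert (H2 : norm (minus (w (S n) t) (F v t)) <= q * (eps / 2)).
    { apply (HF (w n) v); auto; intros s; now apply Hn. }
    nra. }
  destruct (J_correct lambda t psi (exp_mean lambda v t) Hl Hpsi) as [z Hz].
  exists z; rewrite Hfix; exact Hz.
Qed.

(** [sup_contraction] with [q = / (1 + lambda * beta)]; the factor [lambda] cancels, which makes the
    bound uniform in [lambda]. *)
Lemma resolvent_sup {T : Type} (f : T -> R) (lambda C : R) :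
  0 < lambda -> (exists M, forall t, f t <= M) ->
  (forall m, (forall t, f t <= m) -> forall t, (1 + lambda * beta) * f t <= m + lambda * C) ->
  forall t, f t <= C / beta.
Proof.
  intros Hl HM H t.
  assert (Hlb : 0 < lambda * beta) by nra.
  assert (Hq : / (1 + lambda * beta) < 1).
  { rewrite <- Rinv_1; apply Rinv_lt_contravar; lra. }
  replace (C / beta) with
    (/ (1 + lambda * beta) * lambda * C / (1 - / (1 + lambda * beta))).
  2:{ field; repeat split; lra. }
  apply (sup_contraction f); [exact Hq|exact HM|].
  intros m Hm s.
  apply Rmult_le_reg_l with (1 + lambda * beta); [lra|].
  apply Rle_trans with (1 := H m Hm s); right; field; lra.
Qed.

(** At equal times only the history term survives, so [resolvent_sup] applies with [C = K0 * a]. The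
    case [a = 0] is uniqueness. *)
Lemma solves_stability (lambda a : R) (psi1 psi2 v1 v2 : R -> X) :
  0 < lambda -> BUC psi1 -> BUC psi2 -> solves lambda psi1 v1 -> solves lambda psi2 v2 ->
  (forall t, norm (minus (psi1 t) (psi2 t)) <= a) ->
  forall t, norm (minus (v1 t) (v2 t)) <= K0 / beta * a.
Proof.
  intros Hl P1 P2 [B1 S1] [B2 S2] Ha.
  assert (Ha0 : 0 <= a) by (apply Rle_trans with (2 := Ha 0), norm_ge_0).
  replace (K0 / beta * a) with (K0 * a / beta) by (field; lra).
  apply (resolvent_sup (fun t => norm (minus (v1 t) (v2 t))) lambda); [exact Hl| |].
  - destruct (BUC_bound v1 B1) as [M1 [_ HM1]]; destruct (BUC_bound v2 B2) as [M2 [_ HM2]].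
    exists (M1 + M2); intros t; apply Rle_trans with (1 := norm_minus_le _ _).
    generalize (HM1 t) (HM2 t); lra.
  - intros m Hm t.
    destruct (S1 t) as [z1 [A1 R1]]; destruct (S2 t) as [z2 [A2 R2]].
    apply Rle_trans with (1 := shifted_control lambda t t _ _ _ _ _ _ _ _ Hl
      (in_E_history psi1 t P1) (in_E_history psi2 t P2) A1 A2 R1 R2).
    apply Rplus_le_compat.
    + apply exp_mean_contract; auto.
    + apply Rmult_le_compat_l; [lra|now apply control_term_same_time].
Qed.

Lemma solves_bound (M : R) :
  0 <= M -> exists N, 0 <= N /\ forall (lambda : R) (psi v : R -> X),
    0 < lambda -> BUC psi -> (forall t, norm (psi t) <= M) -> solves lambda psi v ->
    forall t, norm (v t) <= N.
Proof.
  intros HM; destruct resolvent_bound as [x0 [C [HC Hres]]].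
  assert (Hx0 := norm_ge_0 x0).
  assert (HCM : 0 <= (C + K0 * M) / beta) by (apply Rdiv_le_0_compat; nra).
  exists ((C + K0 * M) / beta + norm x0); split; [lra|].
  intros lambda psi v Hl Hpsi HpsiM [Hv Sv] t.
  apply Rle_trans with (1 := norm_le_minus _ x0), Rplus_le_compat_r.
  apply (resolvent_sup (fun t => norm (minus (v t) x0)) lambda); [exact Hl| |].
  - destruct (BUC_bound v Hv) as [N [_ HN]]; exists (N + norm x0); intros s.
    apply Rle_trans with (1 := norm_minus_le _ _); generalize (HN s); lra.
  - intros m Hm s; destruct (Sv s) as [z [Az Rz]].
    apply Rle_trans with (1 := Hres lambda s M psi _ _ _ Hl Hpsi HM HpsiM Az Rz).
    apply Rplus_le_compat_r.
    apply Rle_trans with (m + 0 * lambda + 2 * 0 * lambda ^ 2); [|lra].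
    apply exp_mean_near; auto; intros tau _; generalize (Hm (s - tau)); lra.
Qed.

(* Doubling of variables: [e + C / beta * (t - s) ^ 2], with [e] the bound in the
   conclusion, is a supersolution of the inequality that the control condition
   gives for [norm (minus (u t) (v s))]. *)
Lemma solves_comparison (lambda mu eps C : R) (psi1 psi2 u v : R -> X) :
  0 < lambda -> 0 < mu -> 0 <= C -> 0 <= eps -> BUC psi1 -> BUC psi2 ->
  solves lambda psi1 u -> solves mu psi2 v ->
  (forall t s z, A s (history psi2 s) (v s) z -> resolves mu (v s) z (exp_mean mu v s) ->
     control_term t s (history psi1 t) (history psi2 s) (v s) z <= eps + C * (t - s) ^ 2) ->
  forall t, norm (minus (u t) (v t)) <= (eps + 2 * (C / beta) * (lambda + mu)) / beta.
Proof.
  intros Hl Hm HC Heps P1 P2 [Bu Su] [Bv Sv] Hterm.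
  set (e := (eps + 2 * (C / beta) * (lambda + mu)) / beta).
  set (D := C / beta).
  assert (HD : 0 <= D) by (apply Rdiv_le_0_compat; lra).
  assert (He : 0 <= e).
  { apply Rdiv_le_0_compat; [fold D|lra].
    assert (0 <= D * (lambda + mu)) by (apply Rmult_le_pos; lra); lra. }
  assert (Hde : e * beta = eps + 2 * D * (lambda + mu)) by (unfold e, D; field; lra).
  assert (HDb : D * beta = C) by (unfold D; field; lra).
  clearbody e D.
  set (rho := lambda * mu / (lambda + mu)).
  assert (Hrho : 0 < rho) by (apply Rdiv_lt_0_compat; nra).
  assert (Hrl : rho * (lambda + mu) = lambda * mu) by (unfold rho; field; lra).
  assert (Hcmp : forall p : R * R,
    norm (minus (u (fst p)) (v (snd p))) - (e + D * (fst p - snd p) ^ 2) <= 0 / beta).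
  { apply (resolvent_sup (fun p : R * R =>
      norm (minus (u (fst p)) (v (snd p))) - (e + D * (fst p - snd p) ^ 2)) rho); [exact Hrho| |].
    - destruct (BUC_bound u Bu) as [Mu [_ HMu]]; destruct (BUC_bound v Bv) as [Mv [_ HMv]].
      exists (Mu + Mv); intros [t s]; simpl.
      generalize (norm_minus_le (u t) (v s)) (HMu t) (HMv s)
        (Rmult_le_pos _ _ HD (pow2_ge_0 (t - s))); simpl; lra.
    - intros m Hsub [t s]; simpl fst; simpl snd.
      assert (Hsub' : forall t s, norm (minus (u t) (v s)) <= m + e + D * (t - s) ^ 2).
      { intros t' s'; generalize (Hsub (t', s')); simpl fst; simpl snd; lra. }
      destruct (Su t) as [z1 [A1 R1]]; destruct (Sv s) as [z2 [A2 R2]].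
      generalize (two_step_control lambda mu t s _ _ _ _ _ _ _ _ Hl Hm
        (in_E_history psi1 t P1) (in_E_history psi2 s P2) A1 A2 R1 R2).
      (* Shifting [s] and shifting [t] produce opposite linear terms, which cancel after weighting
         by [lambda] and [mu]. The second moments add up to [2 * D * lambda * mu * (lambda + mu)],
         which [Hde] has built into [e]. *)
      assert (H1 : norm (minus (exp_mean mu v s) (u t))
        <= (m + e + D * (t - s) ^ 2) + (2 * D * (t - s)) * mu + 2 * D * mu ^ 2).
      { apply exp_mean_near; auto; intros tau _; rewrite norm_minus_sym.
        apply Rle_trans with (1 := Hsub' t (s - tau)); right; ring. }
      assert (H2 : norm (minus (exp_mean lambda u t) (v s))
        <= (m + e + D * (t - s) ^ 2) + (- (2 * D * (t - s))) * lambda + 2 * D * lambda ^ 2).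
      { apply exp_mean_near; auto; intros tau _.
        apply Rle_trans with (1 := Hsub' (t - tau) s); right; ring. }
      generalize (Hterm t s z2 A2 R2).
      set (T := control_term _ _ _ _ _ _); intros H3 H.
      set (n := norm (minus (u t) (v s))) in *.
      apply Rmult_le_compat_l with (r := lambda) in H1; [|lra].
      apply Rmult_le_compat_l with (r := mu) in H2; [|lra].
      apply Rmult_le_compat_l with (r := lambda * mu) in H3; [|nra].
      apply Rmult_le_reg_l with (lambda + mu); [lra|].
      replace ((lambda + mu) * ((1 + rho * beta) * (n - (e + D * (t - s) ^ 2))))
        with ((lambda + mu + lambda * mu * beta) * n
              - (lambda + mu) * (e + D * (t - s) ^ 2)
              - lambda * mu * (e * beta + D * beta * (t - s) ^ 2))
        by (rewrite <- Hrl; ring).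
      rewrite Hde, HDb; lra. }
  intros t; generalize (Hcmp (t, t)); simpl fst; simpl snd.
  rewrite Rminus_diag; unfold Rdiv; rewrite Rmult_0_l; lra.
Qed.

(** Both points carry the same [lambda] and are shifted by the same [tau], so [q * Rabs (t - s)]
    passes unchanged through the means and is a supersolution for [q = c / beta]. *)
Lemma solves_lipschitz_step (lambda Lh Lk Lpsi M N a : R) (psi v : R -> X) :
  0 < lambda -> 0 <= Lh -> 0 <= Lk -> 0 <= Lpsi -> 0 <= M -> 0 <= a -> BUC psi ->
  (forall s t, norm (minus (h s) (h t)) <= Lh * Rabs (s - t)) ->
  (forall s t, norm (minus (k s) (k t)) <= Lk * Rabs (s - t)) ->
  (forall s t, norm (minus (psi s) (psi t)) <= Lpsi * Rabs (s - t)) ->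
  (forall t, norm (psi t) <= M) -> (forall t, norm (v t) <= N) ->
  solves lambda psi v ->
  (forall s z, A s (history psi s) (v s) z -> resolves lambda (v s) z (exp_mean lambda v s) ->
     G * norm z <= a) ->
  forall t s, norm (minus (v t) (v s))
    <= (Lh * L1 N + a + Lk * L2 M + K0 * Lpsi) / beta * Rabs (t - s).
Proof.
  intros Hl HLh HLk HLpsi HM0 Ha0 Hpsi Hh Hk Hlip HM HN [Bv Sv] Ha.
  assert (HN0 : 0 <= N) by (apply Rle_trans with (2 := HN 0), norm_ge_0).
  assert (HL1 : 0 <= L1 N) by (apply (L1_le N N); lra).
  assert (HL2 : 0 <= L2 M) by (apply (L2_le M M); lra).
  set (c := Lh * L1 N + a + Lk * L2 M + K0 * Lpsi).
  assert (Hc : 0 <= c).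
  { unfold c; repeat apply Rplus_le_le_0_compat; try assumption; apply Rmult_le_pos; lra. }
  set (q := c / beta).
  assert (Hq : 0 <= q) by (apply Rdiv_le_0_compat; lra).
  assert (Hqb : q * beta = c) by (unfold q; field; lra).
  assert (Hcmp : forall p : R * R,
    norm (minus (v (fst p)) (v (snd p))) - q * Rabs (fst p - snd p) <= 0 / beta).
  { apply (resolvent_sup (fun p : R * R =>
      norm (minus (v (fst p)) (v (snd p))) - q * Rabs (fst p - snd p)) lambda); [exact Hl| |].
    - exists (N + N); intros [t s]; simpl.
      generalize (norm_minus_le (v t) (v s)) (HN t) (HN s)
        (Rmult_le_pos _ _ Hq (Rabs_pos (t - s))); lra.
    - intros m Hsub [t s]; simpl fst; simpl snd.
      destruct (Sv t) as [z1 [A1 R1]]; destruct (Sv s) as [z2 [A2 R2]].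
      generalize (shifted_control lambda t s _ _ _ _ _ _ _ _ Hl
        (in_E_history psi t Hpsi) (in_E_history psi s Hpsi) A1 A2 R1 R2).
      assert (H1 : norm (minus (exp_mean lambda v t) (exp_mean lambda v s))
                   <= m + q * Rabs (t - s)).
      { apply exp_mean_contract; auto; intros tau _.
        generalize (Hsub (t - tau, s - tau)); simpl fst; simpl snd.
        replace (t - tau - (s - tau)) with (t - s) by ring; lra. }
      assert (Hr := Rabs_pos (t - s)).
      assert (H2 : control_term t s (history psi t) (history psi s) (v s) z2
                   <= c * Rabs (t - s)).
      { apply Rle_trans with (norm (minus (h t) (h s)) * L1 N + a * Rabs (t - s)
          + norm (minus (k t) (k s)) * L2 M + K0 * (Lpsi * Rabs (t - s))).
        - apply control_term_le; auto; [now apply Rmult_le_pos|now apply (Ha s)|].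
          intros b; replace (t - s) with (t + b - (s + b)) by ring; apply Hlip.
        - generalize (Rmult_le_compat_r _ _ _ HL1 (Hh t s))
            (Rmult_le_compat_r _ _ _ HL2 (Hk t s)); unfold c; lra. }
      apply Rmult_le_compat_l with (r := lambda) in H2; [|lra].
      set (n := norm (minus (v t) (v s))); intros H.
      replace ((1 + lambda * beta) * (n - q * Rabs (t - s)))
        with ((1 + lambda * beta) * n - q * Rabs (t - s)
              - lambda * (q * beta * Rabs (t - s))) by ring.
      rewrite Hqb; lra. }
  intros t s; generalize (Hcmp (t, s)); simpl fst; simpl snd.
  unfold Rdiv at 1; rewrite Rmult_0_l; lra.
Qed.

(** The mean of [l * tau] is [l * lambda], which compensates the factor [/ lambda]: the bound is
    uniform in [lambda]. *)
Lemma resolves_norm_le_lipschitz (lambda l N : R) (v : R -> X) (s : R) (z : X) :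
  0 < lambda -> BUC v -> (forall t, norm (v t) <= N) ->
  (forall t s, norm (minus (v t) (v s)) <= l * Rabs (t - s)) ->
  resolves lambda (v s) z (exp_mean lambda v s) -> norm z <= l + beta * N.
Proof.
  intros Hl Bv HN Hlip Hz.
  replace z with (minus (scal (/ lambda) (minus (v s) (exp_mean lambda v s)))
                        (scal omega (v s)))
    by (rewrite Hz; vec; field; lra).
  apply Rle_trans with (1 := norm_minus_le _ _).
  rewrite !norm_scal_eq, (Rabs_pos_eq (/ lambda)), (Rabs_left omega)
    by (lra || (apply Rlt_le, Rinv_0_lt_compat; lra)).
  apply Rplus_le_compat; [|apply Rmult_le_compat_l; [lra|apply HN]].
  apply Rmult_le_reg_l with lambda; [exact Hl|].
  rewrite <- Rmult_assoc, Rinv_r, Rmult_1_l, norm_minus_sym by lra.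
  apply Rle_trans with (0 + l * lambda + 2 * 0 * lambda ^ 2); [|right; ring].
  apply exp_mean_near; auto; intros tau Htau.
  apply Rle_trans with (1 := Hlip _ _).
  replace (s - tau - s) with (- tau) by ring.
  rewrite Rabs_Ropp, Rabs_pos_eq by lra; right; ring.
Qed.

Lemma lipschitz_nonneg (u : R -> X) :
  lipschitz u ->
  exists L, 0 <= L /\ forall s t, norm (minus (u s) (u t)) <= L * Rabs (s - t).
Proof. intros H; exists (lipschitz_const u); now apply lipschitz_constP. Qed.

(** A Lipschitz constant [m] bounds [G * norm z] by [G * (m + beta * N)], and the preceding step
    returns the constant [G / beta * m + c0 / beta]. As [G < beta], [sup_contraction] on difference
    quotients yields a bound without [lambda]. *)
Lemma solves_lipschitz (M Lpsi : R) :
  lipschitz h -> lipschitz k -> 0 <= M -> 0 <= Lpsi ->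
  exists l, 0 <= l /\ forall (lambda : R) (psi v : R -> X),
    0 < lambda -> BUC psi -> (forall t, norm (psi t) <= M) ->
    (forall s t, norm (minus (psi s) (psi t)) <= Lpsi * Rabs (s - t)) ->
    solves lambda psi v ->
    forall t s, norm (minus (v t) (v s)) <= l * Rabs (t - s).
Proof.
  intros Hh Hk HM0 HLpsi.
  destruct (lipschitz_nonneg h Hh) as [Lh [HLh Hh']].
  destruct (lipschitz_nonneg k Hk) as [Lk [HLk Hk']].
  destruct (solves_bound M HM0) as [N [HN0 HN]].
  assert (HL1 : 0 <= L1 N) by (apply (L1_le N N); lra).
  assert (HL2 : 0 <= L2 M) by (apply (L2_le M M); lra).
  set (c0 := Lh * L1 N + G * (beta * N) + Lk * L2 M + K0 * Lpsi).
  assert (Hc0 : 0 <= c0).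
  { unfold c0; repeat apply Rplus_le_le_0_compat; repeat apply Rmult_le_pos; lra. }
  exists (c0 / beta / (1 - G / beta)); split.
  { apply Rdiv_le_0_compat; [apply Rdiv_le_0_compat; lra|].
    assert (G / beta < 1) by (apply Rlt_div_l; lra); lra. }
  intros lambda psi v Hl Hpsi HM Hlip Sv.
  specialize (HN lambda psi v Hl Hpsi HM Sv).
  assert (Hstep := fun a Ha => solves_lipschitz_step lambda Lh Lk Lpsi M N a psi v
    Hl HLh HLk HLpsi HM0 Ha Hpsi Hh' Hk' Hlip HM HN Sv).
  assert (Bv := proj1 Sv).
  set (f := fun p : R * R => norm (minus (v (fst p)) (v (snd p))) / Rabs (fst p - snd p)).
  assert (Hf : forall l, 0 <= l ->
    (forall t s, norm (minus (v t) (v s)) <= l * Rabs (t - s)) -> forall p, f p <= l).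
  { intros l Hl0 H [t s]; unfold f; simpl fst; simpl snd.
    destruct (Req_dec t s) as [->|Hts].
    - rewrite norm_minus_self; unfold Rdiv; rewrite Rmult_0_l; exact Hl0.
    - apply Rle_div_l; [apply Rabs_pos_lt; lra|apply H]. }
  assert (Hf' : forall l, (forall p, f p <= l) ->
    forall t s, norm (minus (v t) (v s)) <= l * Rabs (t - s)).
  { intros l H t s; destruct (Req_dec t s) as [->|Hts].
    - rewrite norm_minus_self, Rminus_diag, Rabs_R0; lra.
    - generalize (H (t, s)); unfold f; simpl fst; simpl snd; intros H'.
      apply Rle_div_l in H'; [exact H'|apply Rabs_pos_lt; lra]. }
  apply Hf'; apply sup_contraction.
  - apply Rlt_div_l; lra.
  (* The crude bound on [z], depending on [lambda], shows that the difference quotients are bounded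
     at all. *)
  - set (a := G * ((N + N) / lambda + beta * N)).
    assert (Ha0 : 0 <= a).
    { apply Rmult_le_pos; [exact G_ge_0|].
      apply Rplus_le_le_0_compat; [apply Rdiv_le_0_compat; lra|apply Rmult_le_pos; lra]. }
    eexists; apply Hf.
    2:{ apply (Hstep a Ha0); intros s z _ Hz; apply Rmult_le_compat_l; [exact G_ge_0|].
        apply Rle_trans with (1 := resolves_norm_le lambda _ _ _ Hl Hz).
        apply Rplus_le_compat; [|apply Rmult_le_compat_l; [lra|apply HN]].
        apply Rmult_le_compat_r; [apply Rlt_le, Rinv_0_lt_compat; lra|].
        apply Rplus_le_compat; [apply HN|apply (exp_mean_bound lambda v N); auto]. }
    apply Rdiv_le_0_compat; [|lra].
    repeat apply Rplus_le_le_0_compat; try assumption; apply Rmult_le_pos; lra.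
  - intros m Hm.
    assert (Hm0 : 0 <= m).
    { generalize (Hm (0, 0)); unfold f; simpl fst; simpl snd.
      rewrite norm_minus_self; unfold Rdiv; rewrite Rmult_0_l; auto. }
    assert (Ha0 : 0 <= G * (m + beta * N)).
    { apply Rmult_le_pos; [exact G_ge_0|].
      apply Rplus_le_le_0_compat; [exact Hm0|apply Rmult_le_pos; lra]. }
    replace (G / beta * m + c0 / beta)
      with ((Lh * L1 N + G * (m + beta * N) + Lk * L2 M + K0 * Lpsi) / beta)
      by (unfold c0; field; lra).
    apply Hf.
    + apply Rdiv_le_0_compat; [|lra].
      repeat apply Rplus_le_le_0_compat; try assumption; apply Rmult_le_pos; lra.
    + apply (Hstep _ Ha0); intros s z _ Hz; apply Rmult_le_compat_l; [exact G_ge_0|].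
      apply (resolves_norm_le_lipschitz lambda m N v s); auto.
Qed.

(** * The recursion and its limit as [lambda] tends to [0] *)

Definition iterates (lambda : R) (W : nat -> R -> X) : Prop :=
  BUC (W O) /\ forall n, solves lambda (W n) (W (S n)).

Lemma iterates_BUC (lambda : R) (W : nat -> R -> X) (n : nat) :
  iterates lambda W -> BUC (W n).
Proof. intros [H0 H]; destruct n as [|n]; [exact H0|apply (H n)]. Qed.

Lemma iterates_stability (lambda a : R) (W W' : nat -> R -> X) :
  0 < lambda -> iterates lambda W -> iterates lambda W' ->
  (forall t, norm (minus (W O t) (W' O t)) <= a) ->
  forall n t, norm (minus (W n t) (W' n t)) <= (K0 / beta) ^ n * a.
Proof.
  intros Hl HW HW' Ha; induction n as [|n IH]; intros t.
  - rewrite pow_O, Rmult_1_l; apply Ha.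
  - simpl; rewrite Rmult_assoc.
    apply (solves_stability lambda _ (W n) (W' n)); auto.
    + now apply (iterates_BUC lambda).
    + now apply (iterates_BUC lambda).
    + apply HW.
    + apply HW'.
Qed.

Lemma ratio_bounds : 0 <= K0 / beta < 1.
Proof. split; [apply Rdiv_le_0_compat|apply Rlt_div_l]; lra. Qed.

Definition tends (u : R -> R -> X) (v : R -> X) : Prop :=
  forall eps, 0 < eps ->
    at_right 0 (fun lambda => forall t, norm (minus (u lambda t) (v t)) <= eps).

Lemma at_right_0_intro (delta : R) (P : R -> Prop) :
  0 < delta -> (forall lambda, 0 < lambda < delta -> P lambda) -> at_right 0 P.
Proof.
  intros Hd H; exists (mkposreal _ Hd); intros lambda Hb Hl; apply H; split; [exact Hl|].
  assert (Hb' : Rabs (lambda - 0) < delta) by exact Hb.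
  rewrite Rminus_0_r, Rabs_pos_eq in Hb'; lra.
Qed.

Lemma tends_pick (u u' : R -> R -> X) (v v' : R -> X) (eps : R) :
  0 < eps -> tends u v -> tends u' v' ->
  exists lambda, 0 < lambda /\ (forall t, norm (minus (u lambda t) (v t)) <= eps) /\
    forall t, norm (minus (u' lambda t) (v' t)) <= eps.
Proof.
  intros Heps Hu Hu'.
  assert (Hpos : at_right 0 (fun lambda => 0 < lambda))
    by (apply (at_right_0_intro 1); [lra|intros lambda; lra]).
  destruct (filter_ex _ (filter_and _ _ Hpos (filter_and _ _ (Hu eps Heps) (Hu' eps Heps))))
    as [lambda H].
  exists lambda; tauto.
Qed.

Lemma tends_dist (u u' : R -> R -> X) (v v' : R -> X) (a : R) :
  tends u v -> tends u' v' ->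
  (forall lambda, 0 < lambda -> forall t, norm (minus (u lambda t) (u' lambda t)) <= a) ->
  forall t, norm (minus (v t) (v' t)) <= a.
Proof.
  intros Hu Hu' H t; apply le_of_le_eps; intros eps Heps.
  destruct (tends_pick u u' v v' (eps / 2) ltac:(lra) Hu Hu') as [lambda [Hl [H1 H2]]].
  apply Rle_trans with (1 := norm_minus_triangle _ (u lambda t) _).
  rewrite (norm_minus_sym (v t)).
  generalize (norm_minus_triangle (u lambda t) (u' lambda t) (v' t))
    (H1 t) (H2 t) (H lambda Hl t); lra.
Qed.

Lemma tends_closed (Y : (R -> X) -> Prop) (u : R -> R -> X) (v : R -> X) :
  (forall w, Y w -> BUC w) -> closed_in_BUC Y ->
  (forall lambda, 0 < lambda -> Y (u lambda)) -> tends u v -> Y v.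
Proof.
  intros HYb HYc HYu Hu; apply closed_uniform_limit; auto; intros eps Heps.
  destruct (tends_pick u u v v eps Heps Hu Hu) as [lambda [Hl [H _]]].
  exists (u lambda); split; [now apply HYu|].
  intros t; rewrite norm_minus_sym; apply H.
Qed.

Lemma tends_of_cauchy (u : R -> R -> X) :
  (forall eps, 0 < eps -> exists delta, 0 < delta /\
     forall lambda mu, 0 < lambda < delta -> 0 < mu < delta ->
       forall t, norm (minus (u lambda t) (u mu t)) <= eps) ->
  exists v, tends u v.
Proof.
  intros H; apply (uniform_cauchy_limit (at_right 0) u); intros eps Heps.
  destruct (H eps Heps) as [delta [Hd Hcauchy]].
  exists (fun lambda => 0 < lambda < delta); split; [|exact Hcauchy].
  now apply (at_right_0_intro delta).
Qed.

Lemma tends_small (u : R -> R -> X) (v : R -> X) (eps : R) :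
  tends u v -> 0 < eps -> exists delta, 0 < delta /\
    forall lambda, 0 < lambda < delta -> forall t, norm (minus (u lambda t) (v t)) <= eps.
Proof.
  intros Hu Heps; destruct (Hu eps Heps) as [delta Hd].
  exists delta; split; [apply cond_pos|]; intros lambda Hl; apply Hd; [|lra].
  change (Rabs (lambda - 0) < delta); rewrite Rminus_0_r, Rabs_pos_eq; lra.
Qed.

Hypothesis regular : G = 0 \/ (lipschitz h /\ lipschitz k).

(** The three claims are carried together: convergence at stage [n + 1] needs uniform bounds at both
    stages, a bound on [G * norm z] at stage [n + 1], from [G = 0] or a Lipschitz bound, and
    convergence of the histories at stage [n]. *)
Lemma iterates_converge_lipschitz (psi : R -> X) (U : nat -> R -> R -> X) (n : nat) :
  BUC psi -> lipschitz psi ->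
  (forall lambda, 0 < lambda -> U O lambda = psi /\ iterates lambda (fun n => U n lambda)) ->
  (exists M, 0 <= M /\ forall lambda t, 0 < lambda -> norm (U n lambda t) <= M) /\
  (G = 0 \/ exists l, 0 <= l /\ forall lambda s t, 0 < lambda ->
     norm (minus (U n lambda s) (U n lambda t)) <= l * Rabs (s - t)) /\
  exists v, tends (U n) v.
Proof.
  intros Hpsi Hlip HU; induction n as [|n [[M [HM0 HM]] [Hreg [v Hv]]]].
  - split; [|split].
    + destruct (BUC_bound psi Hpsi) as [M [HM0 HM]]; exists M; split; [exact HM0|].
      intros lambda t Hl; rewrite (proj1 (HU lambda Hl)); apply HM.
    + right; destruct (lipschitz_nonneg psi Hlip) as [l [Hl0 Hl]]; exists l.
      split; [exact Hl0|]; intros lambda s t Hlam; rewrite (proj1 (HU lambda Hlam)); apply Hl.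
    + exists psi; intros eps Heps; apply (at_right_0_intro 1); [lra|].
      intros lambda Hl t; rewrite (proj1 (HU lambda (proj1 Hl))), norm_minus_self; lra.
  - assert (HUB : forall lambda, 0 < lambda -> BUC (U n lambda)).
    { intros lambda Hl; apply (iterates_BUC lambda (fun n => U n lambda)), HU, Hl. }
    assert (HUS : forall lambda, 0 < lambda -> solves lambda (U n lambda) (U (S n) lambda)).
    { intros lambda Hl; apply (proj2 (proj2 (HU lambda Hl))). }
    destruct (solves_bound M HM0) as [N [HN0 HN]].
    assert (HN' : forall lambda t, 0 < lambda -> norm (U (S n) lambda t) <= N).
    { intros lambda t Hl; apply (HN lambda (U n lambda)); auto. }
    assert (Hreg' : G = 0 \/ exists l, 0 <= l /\ forall lambda s t, 0 < lambda ->
       norm (minus (U (S n) lambda s) (U (S n) lambda t)) <= l * Rabs (s - t)).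
    { destruct Hreg as [HG|[l [Hl0 Hl]]]; [now left|].
      destruct regular as [HG|[Hh Hk]]; [now left|right].
      destruct (solves_lipschitz M l Hh Hk HM0 Hl0) as [l' [Hl0' Hl']].
      exists l'; split; [exact Hl0'|]; intros lambda s t Hlam.
      apply (Hl' lambda (U n lambda)); auto. }
    split; [now exists N|split; [exact Hreg'|]].
    assert (Hz : exists a, forall lambda s z, 0 < lambda ->
      resolves lambda (U (S n) lambda s) z (exp_mean lambda (U (S n) lambda) s) ->
      G * norm z <= a).
    { destruct Hreg' as [HG|[l [Hl0 Hl]]].
      - exists 0; intros lambda s z _ _; rewrite HG; lra.
      - exists (G * (l + beta * N)); intros lambda s z Hlam Hz.
        apply Rmult_le_compat_l; [exact G_ge_0|].
        apply (resolves_norm_le_lipschitz lambda l N (U (S n) lambda) s); auto.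
        apply HUS; exact Hlam. }
    destruct Hz as [a Ha].
    assert (Hvb : BUC v).
    { apply (tends_closed BUC (U n)); auto; intros w Hw; auto. }
    apply tends_of_cauchy; intros eps Heps.
    (* The control term costs [e], and the history term [3 * K0 * e]: twice for the distance to [v],
       once for the modulus of [v]. Together they take half of [eps * beta]; [d1] below reserves the
       other half for the term in [lambda + mu]. *)
    set (e := eps * beta / (2 * (1 + 3 * K0))).
    assert (He : 0 < e) by (apply Rdiv_lt_0_compat; nra).
    destruct (control_term_quadratic N M a e HN0 HM0 He) as [C1 [HC1 Hterm]].
    destruct (BUC_quadratic_modulus v e Hvb He) as [Cv [HCv Hvq]].
    destruct (tends_small (U n) v e Hv He) as [delta [Hd0 Hd]].
    set (C := C1 + K0 * Cv).
    assert (HC : 0 <= C) by (unfold C; nra).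
    set (d1 := eps * beta * beta / (8 * (C + 1))).
    assert (Hd1 : 0 < d1).
    { apply Rdiv_lt_0_compat; [|lra]; repeat apply Rmult_lt_0_compat; lra. }
    exists (Rmin delta d1); split; [now apply Rmin_pos|].
    intros lambda mu Hlam Hmu t.
    assert (Hmin1 := Rmin_l delta d1); assert (Hmin2 := Rmin_r delta d1).
    assert (Hcmp : norm (minus (U (S n) lambda t) (U (S n) mu t))
              <= (e * (1 + 3 * K0) + e * K0 * 0 + 2 * (C / beta) * (lambda + mu)) / beta).
    { rewrite Rmult_0_r, Rplus_0_r.
      apply (solves_comparison lambda mu _ C (U n lambda) (U n mu));
        try (apply HUB || apply HUS); try lra; [nra|].
      intros t' s z _ Hz.
      apply Rle_trans with (e + C1 * (t' - s) ^ 2 + K0 * (3 * e + Cv * (t' - s) ^ 2));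
        [|unfold C; right; ring].
      assert (Hq := pow2_ge_0 (t' - s)).
      apply Hterm; [nra|apply HN'; lra|intros b; apply HM; lra
                   |apply (Ha mu s z); [lra|exact Hz]|].
      intros b.
      apply Rle_trans with (1 := norm_minus_triangle _ (v (t' + b)) _).
      generalize (norm_minus_triangle (v (t' + b)) (v (s + b)) (U n mu (s + b)))
        (Hd lambda ltac:(lra) (t' + b)) (Hd mu ltac:(lra) (s + b))
        (Hvq (t' + b) (s + b)).
      rewrite (norm_minus_sym (v (s + b))).
      replace (t' + b - (s + b)) with (t' - s) by ring; lra. }
    apply Rle_trans with (1 := Hcmp).
    apply Rle_div_l; [lra|].
    replace (e * (1 + 3 * K0)) with (eps * beta / 2) by (unfold e; field; lra).
    assert (Hsum : 2 * (C / beta) * (lambda + mu) <= eps * beta / 2).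
    { apply Rle_trans with (2 * ((C + 1) / beta) * (2 * d1)).
      - apply Rmult_le_compat; [|lra| |lra].
        + assert (0 <= C / beta) by (apply Rdiv_le_0_compat; lra); lra.
        + apply Rmult_le_compat_l; [lra|].
          apply Rmult_le_compat_r; [apply Rlt_le, Rinv_0_lt_compat; lra|lra].
      - right; unfold d1; field; lra. }
    lra.
Qed.

(** * The scheme from an arbitrary starting point *)

Lemma solves_exists_BUC (lambda : R) (psi : R -> X) :
  0 < lambda -> BUC psi -> exists v, solves lambda psi v.
Proof.
  intros Hl Hpsi.
  destruct (solves_exists BUC lambda psi) as [v [_ Hv]]; auto.
  - exact BUC_linear_subspace.
  - intros u Hu _; exact Hu.
  - exact BUC_translation_invariant.
  - intros psi' f; now apply J_BUC.
  - now exists v.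
Qed.

(** Choice turns the solution step into a total function, so the scheme is a plain iteration; the
    value is a solution for [psi] in [BUC] and positive [lambda]. *)
Definition solution_map (lambda : R) (psi : R -> X) : R -> X :=
  epsilon (inhabits (fun _ => zero)) (solves lambda psi).

Definition scheme (psi : R -> X) (n : nat) (lambda : R) : R -> X :=
  Nat.iter n (solution_map lambda) psi.

Lemma scheme_iterates (psi : R -> X) (lambda : R) :
  BUC psi -> 0 < lambda -> iterates lambda (fun n => scheme psi n lambda).
Proof.
  intros Hpsi Hl.
  assert (Hstep : forall n, BUC (scheme psi n lambda) ->
            solves lambda (scheme psi n lambda) (scheme psi (S n) lambda)).
  { intros n Hn; apply (epsilon_spec (inhabits (fun _ => zero))
      (solves lambda (scheme psi n lambda))); now apply solves_exists_BUC. }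
  split; [exact Hpsi|]; intros n; apply Hstep.
  induction n as [|n IH]; [exact Hpsi|apply (Hstep n IH)].
Qed.

Lemma scheme_recursion (psi : R -> X) :
  BUC psi -> recursion A omega psi (scheme psi).
Proof.
  intros Hpsi lambda Hl; split; [reflexivity|]; intros n.
  assert (HW := scheme_iterates psi lambda Hpsi Hl).
  assert (HB := iterates_BUC lambda _ n HW); simpl in HB.
  split; [now apply approx_solution_iff, HW|]; intros v Hv.
  apply approx_solution_iff in Hv; [|exact Hl].
  apply functional_extensionality; intros t; apply eq_of_norm_minus.
  replace 0 with (K0 / beta * 0) by ring.
  apply (solves_stability lambda 0 (scheme psi n lambda) (scheme psi n lambda)); auto.
  - apply HW.
  - intros s; rewrite norm_minus_self; lra.
Qed.

(** The scheme is chosen in [BUC] without reference to [Y]; by uniqueness each stage coincides with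
    the solution constructed inside [Y]. *)
Lemma scheme_in_subspace (Y : (R -> X) -> Prop) (psi : R -> X) (n : nat) (lambda : R) :
  linear_subspace_BUC Y -> closed_in_BUC Y -> translation_invariant Y ->
  (forall lambda psi f, 0 < lambda -> Y psi -> Y f ->
     Y (fun t => J A omega lambda t (history psi t) (f t))) ->
  0 < lambda -> Y psi -> Y (scheme psi n lambda).
Proof.
  intros HYl HYc HYt HYJ Hl Ypsi.
  assert (HW := scheme_iterates psi lambda (proj1 HYl psi Ypsi) Hl).
  induction n as [|n IH]; [exact Ypsi|].
  destruct (solves_exists Y lambda (scheme psi n lambda)) as [v [Yv Sv]]; auto.
  assert (Hn := iterates_BUC lambda _ n HW); simpl in Hn.
  replace (scheme psi (S n) lambda) with v; [exact Yv|].
  apply functional_extensionality; intros t; apply eq_of_norm_minus.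
  replace 0 with (K0 / beta * 0) by ring.
  apply (solves_stability lambda 0 (scheme psi n lambda) (scheme psi n lambda)); auto.
  - apply HW.
  - intros s; rewrite norm_minus_self; lra.
Qed.

(** Replacing [psi] by a Lipschitz starting point within [eps / 4] changes stage [n] by at most
    [eps / 4] for every [lambda], because the stability factor is at most [1]. *)
Lemma scheme_converges (psi : R -> X) (n : nat) :
  BUC psi -> exists v, tends (scheme psi n) v.
Proof.
  intros Hpsi; apply tends_of_cauchy; intros eps Heps.
  destruct (lipschitz_dense psi (eps / 4) Hpsi ltac:(lra)) as [psi' [Hpsi' [Hlip Hclose]]].
  destruct (iterates_converge_lipschitz psi' (scheme psi') n Hpsi' Hlip) as [_ [_ [v Hv]]].
  { intros lambda Hl; split; [reflexivity|now apply scheme_iterates]. }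
  destruct (tends_small _ v (eps / 4) Hv ltac:(lra)) as [delta [Hd0 Hd]].
  assert (Hnear : forall lambda, 0 < lambda < delta -> forall t,
            norm (minus (scheme psi n lambda t) (v t)) <= eps / 2).
  { intros lambda Hl t.
    apply Rle_trans with (1 := norm_minus_triangle _ (scheme psi' n lambda t) _).
    assert (Hs : norm (minus (scheme psi n lambda t) (scheme psi' n lambda t))
                 <= (K0 / beta) ^ n * (eps / 4)).
    { apply (iterates_stability lambda (eps / 4) (fun n => scheme psi n lambda)
               (fun n => scheme psi' n lambda)); try lra; [| |exact Hclose];
        apply scheme_iterates; auto; lra. }
    assert (Hk : (K0 / beta) ^ n <= 1).
    { rewrite <- (pow1 n); apply pow_incr; generalize ratio_bounds; lra. }
    generalize (Hd lambda Hl t); nra. }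
  exists delta; split; [exact Hd0|]; intros lambda mu Hl Hm t.
  apply Rle_trans with (1 := norm_minus_triangle _ (v t) _).
  rewrite (norm_minus_sym (v t)).
  generalize (Hnear lambda Hl t) (Hnear mu Hm t); lra.
Qed.

Lemma solution_in_subspace (Y : (R -> X) -> Prop) :
  linear_subspace_BUC Y -> closed_in_BUC Y -> translation_invariant Y ->
  (forall lambda psi f, 0 < lambda -> Y psi -> Y f ->
     Y (fun t => J A omega lambda t (history psi t) (f t))) ->
  exists u, Y u /\ is_solution A omega u.
Proof.
  intros HYl HYc HYt HYJ.
  assert (HYb := proj1 HYl).
  (* The zero function belongs to every admissible [Y], so the limit built from it lies in [Y]. *)
  set (o := fun _ : R => zero : X).
  assert (Yo : Y o) by apply HYl.
  assert (Bo := HYb o Yo).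
  set (lim_of := fun psi (H : BUC psi) n =>
    proj1_sig (constructive_indefinite_description _ (scheme_converges psi n H))).
  assert (Hlim : forall psi (H : BUC psi) n, tends (scheme psi n) (lim_of psi H n)).
  { intros psi H n; unfold lim_of; apply proj2_sig. }
  assert (Hq := ratio_bounds); set (q := K0 / beta) in *.
  destruct (solves_bound 0 (Rle_refl 0)) as [N [HN0 HN]].
  assert (Hgeo : forall n t,
            norm (minus (lim_of o Bo (S n) t) (lim_of o Bo n t)) <= N * q ^ n).
  { intros n; apply (tends_dist (scheme o (S n)) (scheme o n)); try apply Hlim.
    intros lambda Hl t; rewrite Rmult_comm.
    assert (HW := scheme_iterates o lambda Bo Hl).
    (* The scheme moved by one stage is again a sequence of iterates, started at stage [1], whose
       distance to [o] is at most [N] for all [lambda]. *)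
    apply (iterates_stability lambda N (fun n => scheme o (S n) lambda)
             (fun n => scheme o n lambda)); [exact Hl| |exact HW|].
    - split; [exact (iterates_BUC lambda _ 1 HW)|intros m; apply (proj2 HW (S m))].
    - intros s; apply Rle_trans with (norm (scheme o 1 lambda s)).
      + right; f_equal; change (scheme o 0 lambda s) with (zero : X); vec.
      + apply (HN lambda o); auto; [|apply (proj2 HW O)].
        intros s'; right; exact norm_zero. }
  destruct (geometric_limit (lim_of o Bo) q N Hq Hgeo) as [u Hu].
  exists u; split.
  - apply closed_uniform_limit; auto; intros eps Heps.
    destruct (Hu eps Heps) as [n Hn]; exists (lim_of o Bo n); split.
    + apply (tends_closed Y (scheme o n)); auto; intros lambda Hl.
      now apply scheme_in_subspace.
    + intros t; rewrite norm_minus_sym; now apply Hn.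
  - intros psi Hpsi; exists (scheme psi), (lim_of psi Hpsi).
    split; [now apply scheme_recursion|split].
    + intros n; apply filterlim_fct; [typeclasses eauto|].
      apply Hlim.
    + apply filterlim_fct; [typeclasses eauto|]; intros eps Heps.
      destruct (BUC_bound psi Hpsi) as [M [HM0 HM]].
      assert (Hdist : forall n t,
                norm (minus (lim_of psi Hpsi n t) (lim_of o Bo n t)) <= q ^ n * M).
      { intros n; apply (tends_dist (scheme psi n) (scheme o n)); try apply Hlim.
        intros lambda Hl.
        apply (iterates_stability lambda M (fun n => scheme psi n lambda)
             (fun n => scheme o n lambda)); auto using scheme_iterates.
        intros t; apply Rle_trans with (2 := HM t); right; f_equal.
        change (scheme o 0 lambda t) with (zero : X); change (scheme psi 0 lambda t) with (psi t).
        vec. }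
      destruct (Hu (eps / 2) ltac:(lra)) as [n1 Hn1].
      destruct (pow_lt_1_zero q) with (y := eps / 2 / (M + 1)) as [n2 Hn2].
      { rewrite Rabs_pos_eq; lra. }
      { apply Rdiv_lt_0_compat; lra. }
      exists (Nat.max n1 n2); intros n Hn t.
      apply Rle_trans with (1 := norm_minus_triangle _ (lim_of o Bo n t) _).
      specialize (Hn2 n ltac:(lia)); rewrite Rabs_pos_eq in Hn2 by (apply pow_le; lra).
      apply Rlt_div_r in Hn2; [|lra].
      assert (Hqn : 0 <= q ^ n) by (apply pow_le; lra).
      generalize (Hdist n t) (Hn1 n ltac:(lia) t); lra.
Qed.

End Evolution.

Theorem theorem3p8
  (X : CompleteNormedModule R_AbsRing) (omega : R) (d : delay)
  (A : R -> (delay_interval d -> X) -> operator X)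
  (HA : forall (t : R) (phi : delay_interval d -> X),
      in_E phi -> m_dissipative (A t phi))
  (Hcontrol :
     (exists (h k : R -> X) (K0 : R) (L1 L2 : R -> R),
        uc_control A h k K0 L1 L2 /\ K0 < - omega) \/
     (exists (g h k : R -> X) (K0 : R) (L1 L2 : R -> R),
        lip_control A g h k K0 L1 L2 /\ Rmax K0 (lipschitz_const g) < - omega))
  (Y : (R -> X) -> Prop)
  (HY_linear : linear_subspace_BUC Y)
  (HY_closed : closed_in_BUC Y)
  (HY_translation : translation_invariant Y)
  (HY_resolvent : forall (lambda : R) (psi f : R -> X),
      0 < lambda -> Y psi -> Y f ->
      Y (fun t => J A omega lambda t (history psi t) (f t))) :
  exists u : R -> X, Y u /\ is_solution A omega u.
Proof.
  destruct Hcontrol as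
    [[h [k [K0 [L1 [L2 [[Bh [Bk [HK0 [HL1 [HL2 Hctl]]]]] HK]]]]]]
    |[g [h [k [K0 [L1 [L2 [[[Bg Lg] [[Bh Lh] [[Bk Lk] [HK0 [HL1 [HL2 Hctl]]]]]] HK]]]]]]]].
  - apply (solution_in_subspace A omega (fun _ => zero) h k K0 0 L1 L2); auto; try lra.
    + apply (BUC_const (zero : X)).
    + intros s t; rewrite norm_minus_self; lra.
    + intros lambda t1 t2 phi1 phi2 x1 z1 x2 z2 Hl E1 E2 A1 A2.
      apply Rle_trans with (1 := Hctl lambda t1 t2 phi1 phi2 x1 z1 x2 z2 Hl E1 E2 A1 A2).
      unfold control_term; rewrite norm_minus_self; right; ring.
  - generalize (Rmax_l K0 (lipschitz_const g)) (Rmax_r K0 (lipschitz_const g)); intros H1 H2.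
    destruct (lipschitz_constP g Lg) as [HG0 HG].
    apply (solution_in_subspace A omega g h k K0 (lipschitz_const g) L1 L2);
      auto using lipschitz_BUC; try lra.
    intros lambda t1 t2 phi1 phi2 x1 z1 x2 z2 Hl E1 E2 A1 A2.
    apply Rle_trans with (1 := Hctl lambda t1 t2 phi1 phi2 x1 z1 x2 z2 Hl E1 E2 A1 A2).
    unfold control_term; right; ring.
Qed.
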